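(* Let $\mathcal{R}$ be a finite subdivision rule with bounded valence and mesh approaching $0$, let $X$ be an expansion complex for $\mathcal{R}$, and let $S$ be a seed for $X$. Then the growth series $\sum_{n=0}^{\infty} b_n z^n$ for $(X,S)$ with respect to the skinny path norm has polynomial growth; that is, $\limsup_{n\to\infty}\frac{\ln(b_n)}{\ln(n)}$ is a (finite) real number, where $b_n$ is the number of tiles of $X$ with skinny path norm at most $n$.
   Context: Finite subdivision rule: a finite subdivision rule $\mathcal{R}$ consists of (1) a finite 2-dimensional CW complex $S_{\mathcal{R}}$, (2) a subdivision $\mathcal{R}(S_{\mathcal{R}})$ of $S_{\mathcal{R}}$, and (3) a continuous cellular map $\sigma_{\mathcal{R}}\colon \mathcal{R}(S_{\mathcal{R}})\to S_{\mathcal{R}}$ whose restriction to every open cell is a homeomorphism onto an open cell. It is required that $S_{\mathcal{R}}$ is the union of its closed 2-cells and that each closed 2-cell is the image of a polygon with at least three edges (called its tile type, with the cell structure having its vertices, its edges and its one face as cells) under a continuous cellular map whose restriction to each open cell is a homeomorphism. $\mathcal{R}$-complex: a 2-dimensional CW complex $X$ which is the union of its closed 2-cells, together with a structure map $f\colon X\to S_{\mathcal{R}}$, which is a continuous cellular map whose restriction to each open cell is a homeomorphism onto an open cell. The subdivision $\mathcal{R}(S_{\mathcal{R}})$ pulls back under $f$ to a subdivision $\mathcal{R}(X)$ of $X$, which is an $\mathcal{R}$-complex with structure map $\sigma_{\mathcal{R}}\circ f$. Recursively, $\mathcal{R}^{n+1}(X)=\mathcal{R}(\mathcal{R}^n(X))$.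 In particular $S_{\mathcal{R}}$ (with the identity map) and each tile type (with its map to $S_{\mathcal{R}}$) are $\mathcal{R}$-complexes. The tiles of an $\mathcal{R}$-complex are its closed 2-cells. Bounded valence: there is a finite upper bound, independent of $n$, for the valences of all vertices of the complexes $\mathcal{R}^n(t)$, for all $n\ge 0$ and all tile types $t$. Mesh approaching $0$: for every open cover $\mathcal{U}$ of $S_{\mathcal{R}}$ there is a positive integer $n$ such that every tile of $\mathcal{R}^n(S_{\mathcal{R}})$ is contained in some element of $\mathcal{U}$. Expansion complex: an expansion complex for $\mathcal{R}$ is an $\mathcal{R}$-complex $X$, with structure map $f$, which is homeomorphic to $\mathbb{R}^2$ and for which there is an orientation-preserving homeomorphism $\varphi\colon X\to X$ (the expansion map) such that $\sigma_{\mathcal{R}}\circ f=f\circ\varphi$. A seed of $X$ is a subcomplex $S\subset X$ which is a closed topological disk such that $S\subset\varphi(S)$ and $X=\bigcup_{n=0}^{\infty}\varphi^n(S)$. Skinny path norm: for a tile $t$ of $X$, $|t|=0$ if $t$ is in $S$; if $t$ is not in $S$, then $|t|$ is the minimal positive integer $n$ such that there exist tiles $t_0,\dots,t_n$ of $X$ with $t_0$ in $S$, $t_n=t$, and $t_i\cap t_{i-1}\neq\emptyset$ for $1\le i\le n$. Growth series: with $b_n=\#\{\text{tiles } t\subset X: |t|\le n\}$, the growth series for $(X,S)$ is $\sum_{n=0}^\infty b_nz^n$. It has polynomial growth of degree $d$ (a real number) if $d=\limsup_{n\to\infty}\frac{\ln(b_n)}{\ln(n)}$, and it has polynomial growth if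 it has polynomial growth of some degree $d$. *)

(* Defs.v *)
From HB Require Import structures.
From mathcomp Require Import all_boot all_order all_algebra.
From mathcomp Require Import finmap.
From mathcomp Require Import all_classical all_reals all_analysis.

Set Implicit Arguments.
Unset Strict Implicit.
Unset Printing Implicit Defensive.

Import Order.TTheory GRing.Theory Num.Theory.
Import numFieldNormedType.Exports.
Local Open Scope classical_set_scope.
Local Open Scope ring_scope.

(* The map f restricts to a homeomorphism from A onto B, both with the
   subspace topology. *)
Definition homeo_on (T U : topologicalType) (f : T -> U)
    (A : set T) (B : set U) : Prop :=
  {within A, continuous f} /\
  exists g : U -> T,
    [/\ {within B, continuous g},
        (forall x, A x -> B (f x) /\ g (f x) = x) &
        (forall y, B y -> A (g y) /\ f (g y) = y)].

Section CWComplexes.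
Variable R : realType.

(* Euclidean balls; 'rV_n carries the product topology. *)
Definition disk n : set 'rV[R]_n := [set x | \sum_i x 0 i ^+ 2 <= 1].
Definition open_disk n : set 'rV[R]_n := [set x | \sum_i x 0 i ^+ 2 < 1].
Definition sphere n : set 'rV[R]_n := [set x | \sum_i x 0 i ^+ 2 = 1].
Arguments disk n : clear implicits.
Arguments open_disk n : clear implicits.
Arguments sphere n : clear implicits.

(* A cell structure on T is recorded by its open cells: C k is the set of
   open k-cells. Closed cells are the closures of the open ones. *)
Definition cellulation (T : Type) := nat -> set (set T).

Definition skeleton (T : Type) (C : cellulation T) (n : nat) : set T :=
  [set x | exists k e, [/\ (k <= n)%N, C k e & e x]].

Definition characteristic_map (T : topologicalType) (C : cellulation T)
    (k : nat) (e : set T) (chi : 'rV[R]_k -> T) : Prop :=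
  [/\ {within disk k, continuous chi},
      homeo_on chi (open_disk k) e &
      exists D : set (set T),
        [/\ finite_set D,
            (forall e', D e' -> exists2 j, (j < k)%N & C j e') &
            chi @` sphere k `<=` \bigcup_(e' in D) e']].

Definition is_CW2 (T : topologicalType) (C : cellulation T) : Prop :=
  [/\ hausdorff_space T,
      (forall x : T, exists k e, C k e /\ e x) /\
      (forall k j e e', C k e -> C j e' -> e `&` e' !=set0 ->
         k = j /\ e = e'),
      (forall k e, C k e -> (k <= 2)%N),
      (forall k e, C k e ->
         exists chi : 'rV[R]_k -> T, characteristic_map C e chi) &
      (forall A : set T,
         (forall k e, C k e -> closed (A `&` closure e)) -> closed A)].

Definition is_tile (T : topologicalType) (C : cellulation T) (t : set T) :
    Prop :=
  exists2 e, C 2%N e & t = closure e.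

Definition union_of_tiles (T : topologicalType) (C : cellulation T) : Prop :=
  \bigcup_(t in is_tile C) t = setT.

Definition subcomplex (T : topologicalType) (C : cellulation T) (S : set T) :
    Prop :=
  forall k e, C k e -> e `&` S !=set0 -> closure e `<=` S.

Definition is_subdivision (T : topologicalType) (C C' : cellulation T) : Prop :=
  is_CW2 C' /\ forall k e', C' k e' -> exists j e, C j e /\ e' `<=` e.

(* Continuous cellular map whose restriction to each open cell is a
   homeomorphism onto an open cell. *)
Definition structure_map (T U : topologicalType) (C : cellulation T)
    (D : cellulation U) (f : T -> U) : Prop :=
  [/\ continuous f,
      (forall n, f @` skeleton C n `<=` skeleton D n) &
      (forall k e, C k e -> exists j d, D j d /\ homeo_on f e d)].

(* The set of ends of edges at the vertex v. Every edge having v as an endpoint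
   contributes its end (e, false); an edge both of whose ends are at v
   contributes (e, true) as well, so that loops count twice. *)
Definition edge_ends (T : topologicalType) (C : cellulation T) (v : T) :
    set (set T * bool) :=
  [set eb : set T * bool | [/\ C 1%N eb.1, closure eb.1 v &
                eb.2 -> closure eb.1 = eb.1 `|` [set v]]].

Definition valence_le (T : topologicalType) (C : cellulation T) (v : T)
    (N : nat) : Prop :=
  (edge_ends C v #<= `I_N)%card.

(* The regular m-gon inscribed in the unit circle. *)
Definition polygon_vertex (m i : nat) : 'rV[R]_2 :=
  \row_(j < 2) (if j == 0 then cos (2 * pi * i%:R / m%:R)
                else sin (2 * pi * i%:R / m%:R)).

Definition polygon (m : nat) : set 'rV[R]_2 :=
  [set x | exists w : 'I_m -> R,
     [/\ forall i, 0 <= w i, \sum_i w i = 1 &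
         x = \sum_i w i *: polygon_vertex m i]].

Definition polygon_edge (m i : nat) : set 'rV[R]_2 :=
  [set x | exists s : R, [/\ 0 < s, s < 1 &
     x = (1 - s) *: polygon_vertex m i + s *: polygon_vertex m i.+1]].

Definition polygon_cells (m : nat) : cellulation (polygon m) :=
  fun k => [set A |
    match k with
    | 0 => exists2 i, (i < m)%N & A = set_val @^-1` [set polygon_vertex m i]
    | 1 => exists2 i, (i < m)%N & A = set_val @^-1` polygon_edge m i
    | 2 => A = set_val @^-1` (interior (polygon m))
    | _ => False
    end].

End CWComplexes.

Arguments polygon R m : clear implicits.
Arguments polygon_cells R m : clear implicits.

Section SubdivisionRules.
Variable R : realType.

(* The 2-cells c of fsr_cells index the tile types: the tile type of c is the
   polygon with fsr_sides c edges, with its map fsr_tile c to the complex.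
   The values of fsr_sides and fsr_tile off the 2-cells are irrelevant. *)
Record subdivision_rule := SubdivisionRule {
  fsr_space :> topologicalType;
  fsr_cells : cellulation fsr_space;
  fsr_subcells : cellulation fsr_space;
  fsr_map : fsr_space -> fsr_space;
  fsr_sides : set fsr_space -> nat;
  fsr_tile : forall c : set fsr_space,
    set_type (polygon R (fsr_sides c)) -> fsr_space;
  fsr_cw : is_CW2 R fsr_cells;
  fsr_finite : forall k, finite_set (fsr_cells k);
  fsr_union : union_of_tiles fsr_cells;
  fsr_subdivision : is_subdivision R fsr_cells fsr_subcells;
  fsr_map_structure : structure_map fsr_subcells fsr_cells fsr_map;
  fsr_sides_ge3 : forall c, fsr_cells 2%N c -> (3 <= fsr_sides c)%N;
  fsr_tile_structure : forall c, fsr_cells 2%N c ->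
    structure_map (polygon_cells R (fsr_sides c)) fsr_cells (@fsr_tile c);
  fsr_tile_image : forall c, fsr_cells 2%N c ->
    range (@fsr_tile c) = closure c
}.

Variable F : subdivision_rule.

Definition is_Rcomplex (X : topologicalType) (C : cellulation X)
    (f : X -> F) : Prop :=
  [/\ is_CW2 R C, union_of_tiles C & structure_map C (@fsr_cells F) f].

(* The pullback under f of the subdivision of the complex of F: each open cell
   e of X is cut along the homeomorphism from e onto f @` e. *)
Definition subdivide (X : Type) (C : cellulation X) (f : X -> F) :
    cellulation X :=
  fun k => [set A | exists j e c,
    [/\ C j e, fsr_subcells k c, c `<=` f @` e & A = e `&` f @^-1` c]].

Fixpoint iter_subdivide (X : Type) (C : cellulation X) (f : X -> F) (n : nat) :
    cellulation X :=
  if n is n'.+1 then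
    subdivide (iter_subdivide C f n') (fun x => iter n' (@fsr_map F) (f x))
  else C.

Definition bounded_valence : Prop :=
  exists N : nat, forall (n : nat) (c : set F), fsr_cells 2%N c ->
    forall v : set_type (polygon R (fsr_sides c)),
      iter_subdivide (polygon_cells R (fsr_sides c)) (@fsr_tile F c) n
        0%N [set v] ->
      valence_le
        (iter_subdivide (polygon_cells R (fsr_sides c)) (@fsr_tile F c) n)
        v N.

Definition mesh_to_zero : Prop :=
  forall U : set (set F),
    (forall V, U V -> open V) -> \bigcup_(V in U) V = setT ->
    exists2 n, (0 < n)%N &
      forall t, is_tile (iter_subdivide (@fsr_cells F) id n) t ->
        exists2 V, U V & t `<=` V.

(* The path g : [0, 1] -> R^2 \ {p} has winding number k around p if it is
   closed: th is a continuous choice of its argument, rho its distance to p. *)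
Definition winding_number (g : R -> 'rV[R]_2) (p : 'rV[R]_2) (k : int) : Prop :=
  exists th rho : R -> R,
    [/\ {within `[0, 1], continuous th},
        (forall s : R, 0 <= s <= 1 ->
           [/\ 0 < rho s,
               g s 0 0 = p 0 0 + rho s * cos (th s) &
               g s 0 1 = p 0 1 + rho s * sin (th s)]) &
        th 1 - th 0 = 2 * pi * k%:~R].

(* Orientation-preserving means local degree 1, for X homeomorphic to R^2: in
   any global chart h, phi acts as the identity on
   H_1(R^2 \ {h p}) = Z = H_1(R^2 \ {h (phi p)}), where the class of a loop is
   its winding number. *)
Definition orientation_preserving (X : topologicalType) (phi : X -> X) : Prop :=
  forall h : X -> 'rV[R]_2, homeo_on h setT setT ->
  forall (g : R -> X) (p : X) (k : int),
    {within `[0, 1], continuous g} -> g 0 = g 1 ->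
    (forall s : R, 0 <= s <= 1 -> g s <> p) ->
    winding_number (h \o g) (h p) k ->
    winding_number (h \o phi \o g) (h (phi p)) k.

Definition expansion_complex (X : topologicalType) (C : cellulation X)
    (f : X -> F) (phi : X -> X) : Prop :=
  [/\ is_Rcomplex C f,
      exists h : X -> 'rV[R]_2, homeo_on h setT setT,
      homeo_on phi setT setT,
      orientation_preserving phi &
      forall x, fsr_map (f x) = f (phi x)].

Definition is_seed (X : topologicalType) (C : cellulation X) (phi : X -> X)
    (S : set X) : Prop :=
  [/\ subcomplex C S,
      exists h : 'rV[R]_2 -> X, homeo_on h (@disk R 2) S,
      S `<=` phi @` S &
      \bigcup_n (iter n phi @` S) = setT].

End SubdivisionRules.

Section SkinnyPaths.
Variables (X : topologicalType) (C : cellulation X) (S : set X).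

Definition skinny_path (t : set X) (n : nat) : Prop :=
  exists s : nat -> set X,
    [/\ (forall i, (i <= n)%N -> is_tile C (s i)),
        s 0%N `<=` S, s n = t &
        (forall i, (1 <= i <= n)%N -> s i `&` s i.-1 !=set0)].

(* The tile t has skinny path norm n. *)
Definition skinny_norm (t : set X) (n : nat) : Prop :=
  (t `<=` S /\ n = 0%N) \/
  [/\ ~ (t `<=` S), (0 < n)%N, skinny_path t n &
      forall m, (0 < m)%N -> skinny_path t m -> (n <= m)%N].

Definition skinny_ball (n : nat) : set (set X) :=
  [set t | is_tile C t /\ exists2 m, (m <= n)%N & skinny_norm t m].

Definition growth_coef (n : nat) : nat := (#|` fset_set (skinny_ball n)|)%fset.

End SkinnyPaths.

Definition polynomial_growth_degree (R : realType) (b : nat -> nat) (d : R) :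
    Prop :=
  limn_esup (fun n => (ln (b n)%:R / ln n%:R : R)%:E) = d%:E.

Definition polynomial_growth (R : realType) (b : nat -> nat) : Prop :=
  exists d : R, polynomial_growth_degree b d.

(* Main.v *)
Require Import Defs.
From mathcomp Require Import all_boot all_order all_algebra.
From mathcomp Require Import finmap.
From mathcomp Require Import all_classical all_reals all_analysis.
From mathcomp Require Import zify ring lra.

Set Implicit Arguments.
Unset Strict Implicit.
Unset Printing Implicit Defensive.

Import Order.TTheory GRing.Theory Num.Theory.
Import numFieldNormedType.Exports.
Local Open Scope classical_set_scope.
Local Open Scope ring_scope.

(** Let psi be the inverse of the expansion map phi.  As phi carries the
    subdivision of X onto X itself, psi^n maps every tile of X onto a tile of
    the n-th subdivision, which lies in a single tile of X.  Polynomial growth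
    comes from comparing two exponential rates.

    - Volume.  A tile e is recovered from the tile around psi(e) and the 2-cell
      of the subdivided rule over which psi(e) lies.  So the number of tiles
      that psi^n pushes into the seed S grows at most by a constant factor when
      n increases by one ([seed_cells_count]).

    - Distance.  There is N such that, for every tile t, all the tiles of X that
      meet psi^N(t) share a point ([exists_star_level]).  If u, t, w are
      consecutive in a chain of tiles, then the tiles around psi^N(u) and
      psi^N(w) both meet psi^N(t), hence they meet each other: every other tile
      of the chain may be dropped, and psi^N halves the length of chains that
      start in S ([skinny_path_halve]).  After k halvings a chain of length at
      most 2^k has length one, and the finitely many tiles touching S are
      pushed into S by a fixed power of psi ([skinny_path_absorbed]).

    Together, the ball of radius 2^k has at most a * b^k tiles
    ([skinny_ball_count]), and b^k is a power of the radius.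

    The point of the distance estimate is that one N serves the infinitely many
    tiles of X.  This holds because there are finitely many tile types: the map
    from the polygon of a tile type to the complex of the rule lifts to every
    tile of X of that type ([tile_lift]).  The lift is clear over the open face;
    it extends to the boundary because the structure map has finite fibres on
    a tile and the face of a polygon is connected near each boundary point, so
    that there is only one possible limit ([extend_to_boundary]).  Every point
    of the complex has a neighbourhood V so small that a connected part of a
    polygon lying over V touches only those closed sides and vertices that pass
    through one point of the polygon ([fiber_localization]).  Mesh approaching
    zero provides N such that the tiles of the N-th subdivision lie over such
    sets V, and the lift carries the point of the polygon to a point of X common
    to all tiles that touch.  *)

(** * Connectedness, compactness, and extension of a lift to the boundary *)

Lemma connected_sub_open (T : topologicalType) (D : set (set T)) (Q : set T) :
  connected Q -> Q !=set0 -> (forall U, D U -> open U) ->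
  (forall U V, D U -> D V -> U `&` V !=set0 -> U = V) ->
  Q `<=` \bigcup_(U in D) U -> exists2 U, D U & Q `<=` U.
Proof.
move=> cQ [x Qx] oD dD QD; have [U DU Ux] := QD _ Qx; exists U => //.
suff <- : Q `&` U = Q by move=> ? [].
apply: cQ; first by exists x.
  by exists U => //; exact: oD.
exists (~` \bigcup_(V in D `&` [set V | V <> U]) V).
  by apply: open_closedC; apply: bigcup_open => V [DV _]; exact: oD.
apply/seteqP; split=> z [Qz Uz]; split => //.
  by move=> [V [DV VU] Vz]; apply: VU; apply: dD => //; exists z.
have [V DV Vz] := QD _ Qz; have [<-//|VU] := pselect (V = U).
by exfalso; apply: Uz; exists V.
Qed.

(** The members are closed only relatively to [Q]: a cell of a complex is not
    closed, but it is closed within the preimage of a cell. *)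
Lemma connected_sub_closure (T : topologicalType) (D : set (set T))
    (Q : set T) :
  connected Q -> Q !=set0 -> finite_set D ->
  (forall U V, D U -> D V -> U `&` V !=set0 -> U = V) ->
  (forall U, D U -> Q `&` closure U `<=` U) ->
  Q `<=` \bigcup_(U in D) U -> exists2 U, D U & Q `<=` U.
Proof.
move=> cQ [x Qx] fD dD clD QD; have [U DU Ux] := QD _ Qx; exists U => //.
have QU z : Q z -> closure U z -> U z by move=> Qz Uz; apply: (clD U).
suff <- : Q `&` closure U = Q by move=> z [Qz Uz]; exact: QU.
apply: cQ; first by exists x; split => //; exact: subset_closure.
  exists (~` \bigcup_(V in D `&` [set V | V <> U]) closure V).
    apply: closed_openC; apply: closed_bigcup.
      by apply: sub_finite_set fD; exact: subIsetl.
    by move=> V _; exact: closed_closure.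
  apply/seteqP; split=> z [Qz Uz]; split => //.
    move=> [V [DV VU] Vz]; apply: VU; apply: dD => //; exists z; split.
      exact: (clD V).
    exact: QU.
  have [V DV Vz] := QD _ Qz; have [<-|VU] := pselect (V = U).
    exact: subset_closure.
  by exfalso; apply: Uz; exists V => //; exact: subset_closure.
by exists (closure U) => //; exact: closed_closure.
Qed.

Lemma hausdorff_finite_sep (X : topologicalType) (x : X) (L : set X) :
  hausdorff_space X -> finite_set L -> ~ L x ->
  exists A B : set X, [/\ open A, open B, A x, L `<=` B & A `&` B = set0].
Proof.
move=> hX fL Lx.
have /choice[AB hAB] (z : X) : exists AB : set X * set X, L z ->
    [/\ open AB.1, open AB.2, AB.1 x, AB.2 z & AB.1 `&` AB.2 = set0].
  have [Lz|nLz] := pselect (L z); last by exists (set0, set0).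
  have xz : x != z by apply/eqP => xz; apply: Lx; rewrite xz.
  move: hX; rewrite open_hausdorff => /(_ _ _ xz)[[A B]] /=.
  rewrite !inE => -[Ax Bz] [oA oB AB0]; exists (A, B) => _; split => //.
exists (~` \bigcup_(z in L) ~` (AB z).1), (\bigcup_(z in L) (AB z).2); split.
- apply: closed_openC; apply: closed_bigcup => // z Lz.
  by apply: open_closedC; case: (hAB _ Lz).
- by apply: bigcup_open => z Lz; case: (hAB _ Lz).
- by move=> [z Lz]; apply; case: (hAB _ Lz).
- by move=> z Lz; exists z => //; case: (hAB _ Lz).
- apply/seteqP; split=> // w [Aw [z Lz Bw]]; apply: Aw; exists z => // Aw.
  by have [_ _ _ _ /seteqP[+ _]] := hAB _ Lz; apply; split; [exact: Aw|].
Qed.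

Lemma continuous_closed_image (X Y : topologicalType) (f : X -> Y) (T : set X) :
  hausdorff_space Y -> continuous f -> compact T -> closed (f @` T).
Proof.
move=> hY cf cT; apply: compact_closed => //; apply: continuous_compact => //.
exact: continuous_subspaceT.
Qed.

(** A lift [G0] of [g] through [f], given on a subset [O] of [K], extends to
    all of [K]: at a boundary point [p] the cluster values of [G0] lie in the
    finite fibre of [f] over [g p], and as [O] is connected near [p] they
    cannot be spread over several of its points. *)
Section Extension.
Variables (K X Y : topologicalType) (O : set K) (T : set X).
Variables (f : X -> Y) (g : K -> Y) (G0 : K -> X).
Hypotheses (hX : hausdorff_space X) (hY : hausdorff_space Y).
Hypotheses (cT : compact T) (cf : continuous f) (cg : continuous g).
Hypothesis Oconn : forall (p : K) (V : set K), nbhs p V ->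
  exists W, [/\ nbhs p W, W `<=` V & connected (W `&` O)].
Hypothesis Odense : forall (p : K) (V : set K), nbhs p V -> V `&` O !=set0.
Hypothesis cG0 : {within O, continuous G0}.
Hypothesis G0T : forall p, O p -> T (G0 p) /\ f (G0 p) = g p.
Hypothesis ffib : forall y, finite_set (T `&` f @^-1` [set y]).

Let closed_sub_compact (C : set X) : closed C -> compact (T `&` C).
Proof. by move=> cC; exact: compact_closedI. Qed.

(** Over a small neighbourhood of [p], the compact set [T] splits into a part
    near [x] and a part near the rest of the fibre. *)
Let fiber_split (p : K) (x : X) (U : set X) : T x -> f x = g p -> nbhs x U ->
  exists W A B, [/\ nbhs p W, open A, open B, A `&` B = set0 &
    [/\ A `<=` U, A x, connected (W `&` O) &
        forall p', W p' -> forall z, T z -> f z = g p' -> A z \/ B z]].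
Proof.
move=> Tx fx; rewrite nbhsE => -[U' [oU' U'x] U'U].
have [||A [B [oA oB Ax LB AB]]] :=
    @hausdorff_finite_sep _ x (T `&` f @^-1` [set g p] `\ x) hX.
  by apply: sub_finite_set (ffib (g p)) => z [].
  by move=> [_ /=]; apply.
pose C := T `&` ~` ((A `&` U') `|` B).
have cC : closed (f @` C).
  apply: continuous_closed_image => //; apply: closed_sub_compact.
  by apply: open_closedC; apply: openU => //; exact: openI.
have nV : nbhs p (g @^-1` (~` (f @` C))).
  apply: cg; apply: open_nbhs_nbhs; split; first exact: closed_openC.
  move=> [z [Tz ABz] fz]; apply: ABz.
  have [->|zx] := pselect (z = x); first by left.
  by right; apply: LB.
have [W [nW WV cW]] := Oconn nV.
exists W, (A `&` U'), B; split => //; first exact: openI.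
  by rewrite setIAC AB set0I.
split => //; first by move=> z [_ /U'U].
move=> p' /WV Vp' z Tz fz; apply: contrapT => zAB; apply: Vp'.
by exists z.
Qed.

Let fiber_lim (p : K) : exists x : X, [/\ T x, f x = g p & forall U, nbhs x U ->
  exists W A B, [/\ nbhs p W, open A, open B, A `&` B = set0 &
    [/\ A `<=` U, (forall q, W q -> O q -> A (G0 q)) &
        forall p', W p' -> forall z, T z -> f z = g p' -> A z \/ B z]]].
Proof.
pose Fp := G0 @ within O (nbhs p).
have Fpr : ProperFilter Fp.
  apply: fmap_proper_filter; split; last exact: within_filter.
  rewrite /within => n0; have [q [Vq Oq]] := Odense n0; exact: (Vq Oq).
have FT : Fp T.
  rewrite /Fp /fmap/= /within/=; apply: nearW => q Oq; exact: (G0T Oq).1.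
have [x [Tx clx]] := cT Fpr FT.
have fx : f x = g p.
  apply/hY => A B nA nB.
  have FB : Fp (f @^-1` B).
    have := cg nB; rewrite /Fp !nbhs_simpl /fmap/= /within /=.
    by apply: filterS => q gq Oq /=; rewrite (G0T Oq).2.
  have [z [Bz Az]] := clx _ _ FB (cf nA); by exists (f z).
exists x; split => // U nU.
have [W [A [B [nW oA oB AB [AU Ax cW WAB]]]]] := fiber_split Tx fx nU.
exists W, A, B; split => //; split => //.
have GW z : (G0 @` (W `&` O)) z -> A z \/ B z.
  by case=> q [Wq Oq] <-; have [] := G0T Oq; exact: WAB.
have [q [Wq Oq]] := Odense nW.
have [|||||U' +] := @connected_sub_open _ [set A; B] (G0 @` (W `&` O)).
- apply: connected_continuous_connected => //.
  by apply: continuous_subspaceW cG0 => z [].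
- by exists (G0 q), q.
- by move=> ? [->|->].
- by move=> ? ? [->|->] [->|->] //; rewrite ?(setIC B) AB => -[].
- by move=> z /GW[]; [exists A|exists B] => //; [left|right].
case=> -> sub; first by move=> q' Wq' Oq'; apply: sub; exists q'.
have FB : Fp B.
  rewrite /Fp /fmap /= /within /=; apply: filterS nW => q' Wq' Oq'.
  by apply: sub; exists q'.
have nA : nbhs x A by exact: open_nbhs_nbhs.
have [z [Bz Az]] := clx _ _ FB nA.
by move/seteqP: AB => [/(_ z) /= AB _]; case: AB.
Qed.

Lemma extend_to_boundary :
  exists G : K -> X, [/\ continuous G, (forall p, O p -> G p = G0 p),
    (forall p, T (G p)) & forall p, f (G p) = g p].
Proof.
have [G hG] := choice fiber_lim; exists G; split.
- move=> p U nU; have [_ _ /(_ _ nU)] := hG p.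
  move=> [W [A [B [nW oA oB AB [AU GA WAB]]]]].
  have : nbhs p W° by exact: nbhs_interior.
  rewrite nbhs_simpl /=; apply: filterS => p' nWp'.
  have [Tp' fp' hp'] := hG p'.
  have [/AU//|Bp'] := WAB p' (nbhs_singleton nWp') _ Tp' fp'.
  have [|W' [A' [B' [nW' _ _ _ [A'B GA' _]]]]] := hp' B.
    exact: open_nbhs_nbhs.
  have [q [[Wq W'q] Oq]] := Odense (filterI nWp' nW').
  move/seteqP: AB => [/(_ (G0 q)) AB _]; exfalso; apply: AB.
  by split; [exact: GA|apply/A'B/GA'].
- move=> p Op; apply/hX => U V nU nV.
  have [_ _ /(_ _ nU)] := hG p.
  move=> [W [A [B [nW oA oB AB [AU GA WAB]]]]].
  exists (G0 p); split; last exact: nbhs_singleton.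
  by apply/AU/GA => //; exact: nbhs_singleton.
- by move=> p; case: (hG p).
- by move=> p; case: (hG p).
Qed.

End Extension.

(** Around the finitely many points of the fibre over [y] one takes disjoint
    neighbourhoods that avoid every closed piece not passing through their
    point; by compactness they contain the preimage of a neighbourhood of [y],
    and a connected set over it stays in one of them. *)
Lemma fiber_localization (K Y : topologicalType) (g : K -> Y)
    (Pc : set (set K)) (y : Y) :
  hausdorff_space K -> compact [set: K] -> hausdorff_space Y -> continuous g ->
  finite_set Pc -> finite_set (g @^-1` [set y]) ->
  exists V, [/\ open V, V y & forall Q : set K,
    connected Q -> Q !=set0 -> g @` Q `<=` V ->
    exists p, forall k, Pc k -> closure Q `&` closure k !=set0 -> closure k p].
Proof.
move=> hK cK hY cg fPc fL; set L := _ @^-1` _ in fL.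
have cl1 (z : K) : closed [set z].
  exact: (accessible_closed_set1 (hausdorff_accessible hK)).
pose N p := ~` ((\bigcup_(k in Pc `&` [set k | ~ closure k p]) closure k) `|`
  \bigcup_(q in L `\ p) [set q]).
have /choice[W hW] (p : K) : exists W : set K, [/\ open W, W p &
    closure W `<=` N p].
  have oN : nbhs p (N p).
    apply: open_nbhs_nbhs; split.
      apply: closed_openC; apply: closedU; apply: closed_bigcup.
      - by apply: sub_finite_set fPc => ? [].
      - by move=> *; exact: closed_closure.
      - by apply: sub_finite_set fL => ? [].
      - by [].
    by move=> [[k [_ kp]]|[q [_ qp] /= pq]]; [|apply: qp].
  have := @compact_regular K p setT hK cK filterT (N p) oN.
  move=> [W0]; rewrite nbhsE => -[W [oW Wp] WW0] WN; exists W; split => //.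
  exact: (subset_trans (closureS WW0)).
(* removing the closures of the others makes the neighbourhoods disjoint *)
pose W' p := W p `&` ~` \bigcup_(q in L `\ p) closure (W q).
have oW' p : open (W' p).
  apply: openI; first by case: (hW p).
  apply: closed_openC; apply: closed_bigcup; last by move=> *; exact: closed_closure.
  by apply: sub_finite_set fL => ? [].
have W'p p : L p -> W' p p.
  move=> Lp; split; first by case: (hW p).
  move=> [q [Lq qp]]; have [_ _ +] := hW q => /[apply]; apply.
  by right; exists p => //; split => // pq; apply: qp; rewrite pq.
have dW' p q : L p -> L q -> W' p `&` W' q !=set0 -> p = q.
  move=> Lp Lq [z [[Wp nq] [Wq _]]]; apply: contrapT => pq; apply: nq.
  exists q; first by split => // qp; apply: pq; rewrite qp.
  exact: subset_closure.
exists (~` (g @` (~` \bigcup_(p in L) W' p))); split.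
- apply: closed_openC; apply: continuous_closed_image => //.
  rewrite -[X in compact X]setTI; apply: compact_closedI => //.
  by apply: open_closedC; exact: bigcup_open.
- move=> [p nWp gp]; apply: nWp; exists p => //; exact: W'p.
- move=> Q cQ Q0 QV.
  have [|||_ [p Lp <-] QW] := connected_sub_open (D := W' @` L) cQ Q0.
  + by move=> _ [p Lp <-].
  + by move=> _ _ [p Lp <-] [q Lq <-] /dW' ->.
  + move=> q Qq; apply: contrapT => nq; apply: (QV (g q)); first by exists q.
    by exists q => // -[p Lp Wq]; apply: nq; exists (W' p) => //; exists p.
  exists p => k Pk [z [Qz kz]]; apply: contrapT => kp.
  have [_ _ /(_ z)] := hW p; apply.
    by apply: closureS Qz; apply: (subset_trans QW) => ? [].
  by left; exists k.
Qed.

(** If [A] were infinite, its cofinite subsets would generate a filter with a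
    cluster point, although every subset of [A] is closed. *)
Lemma compact_discrete_finite (T : topologicalType) (K A : set T) :
  compact K -> A `<=` K -> (forall B, B `<=` A -> closed B) -> finite_set A.
Proof.
move=> cK AK clA; apply: contrapT => infA.
pose F : set_system T := [set B | finite_set (A `\` B)].
have Fp : ProperFilter F.
  split; first by rewrite /F /= setD0.
  split.
  - by rewrite /F /= setDT; exact: finite_set0.
  - by move=> P Q FP FQ; rewrite /F /= setDIr finite_setU.
  - by move=> P Q PQ; apply: sub_finite_set => z [Az nQ]; split => // /PQ.
have FK : F K by rewrite /F /= (_ : A `\` K = set0) ?setD_eq0.
have [x [Kx clx]] := cK F Fp FK.
have FB : F (A `\ x).
  by rewrite /F /= setDD; apply: sub_finite_set (finite_set1 x) => z [].
have [] := clx (A `\ x) (~` (A `\ x)) FB; last by move=> z [].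
apply: open_nbhs_nbhs; split; last by case=> _; apply.
by apply: closed_openC; apply: clA => z [].
Qed.

(** * Euclidean disks, and the topological distinction of dimensions at most two *)

Section Planar.
Variable R : realType.

Lemma segment_path_continuous n (p q : 'rV[R]_n) :
  continuous (fun s : R => p + s *: (q - p)).
Proof.
by move=> s; apply: cvgD; [exact: cvg_cst|apply: scalel_continuous].
Qed.

Lemma star_shaped_connected n (A : set 'rV[R]_n) (p : 'rV[R]_n) :
  (forall q (s : R), A q -> 0 <= s <= 1 -> A (p + s *: (q - p))) ->
  connected A.
Proof.
move=> hA.
have [[q0 Aq0]|A0] := pselect (A !=set0); last first.
  have -> : A = set0 by apply/seteqP; split=> z // Az; case: A0; exists z.
  exact: connected0.
have -> : A = \bigcup_(q in A) ((fun s : R => p + s *: (q - p)) @` `[0, 1]).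
  apply/seteqP; split => [q Aq|_ [q Aq] [s s01 <-]].
    exists q => //; exists 1; first by rewrite /= in_itv /= ler01 lexx.
    by rewrite scale1r addrC subrK.
  by apply: hA => //; move: s01; rewrite /= in_itv.
apply: bigcup_connected.
  exists p => q Aq; exists 0; first by rewrite /= in_itv /= ler01 lexx.
  by rewrite scale0r addr0.
move=> q Aq; apply: connected_continuous_connected.
  exact: segment_connected.
by apply: continuous_subspaceT; exact: segment_path_continuous.
Qed.

(** Of three non-collinear points, the one with the middle value has its value
    attained again on the opposite side, by the intermediate value theorem. *)
Lemma open_no_injection_line (B : set 'rV[R]_2) (h : 'rV[R]_2 -> R) :
  open B -> B !=set0 -> {within B, continuous h} ->
  (forall x y, B x -> B y -> h x = h y -> x = y) -> False.
Proof.
move=> oB [c Bc] ch ih.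
have /nbhs_ballP[r /= r0 rB] : nbhs c B by exact: open_nbhs_nbhs.
have r20 : 0 < r / 2 by rewrite divr_gt0.
pose pt (u v : R) : 'rV[R]_2 := c + \row_i (if i == 0 then u else v).
have ptE0 u v : pt u v 0 0 = c 0 0 + u by rewrite !mxE.
have ptE1 u v : pt u v 0 1 = c 0 1 + v by rewrite !mxE.
have Bpt u v : `|u| < r -> `|v| < r -> B (pt u v).
  move=> ur vr; apply: rB; rewrite -ball_normE /= /ball_ /= /pt opprD addNKr.
  rewrite normrN [X in X < _]/Num.norm /= mx_normrE.
  apply/bigmax_ltP; split => // i _; rewrite !mxE.
  by case: ifP.
have Bseg u v u' v' s : `|u| < r -> `|v| < r -> `|u'| < r -> `|v'| < r ->
    0 <= s <= 1 -> B (pt u v + s *: (pt u' v' - pt u v)).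
  move=> ur vr u'r v'r s01.
  suff -> : pt u v + s *: (pt u' v' - pt u v) =
      pt (u + s * (u' - u)) (v + s * (v' - v)).
    have key (x y : R) : `|x| < r -> `|y| < r -> `|x + s * (y - x)| < r.
      case/andP: s01 => s0 s1.
      rewrite !ltr_norml => /andP[x1 x2] /andP[y1 y2].
      have [->|sn0] := eqVneq s 0; first by rewrite mul0r addr0 x1.
      have sp : 0 < s by rewrite lt0r sn0.
      have h1 : 0 < s * (r - y) by apply: mulr_gt0 => //; lra.
      have h2 : 0 < s * (y + r) by apply: mulr_gt0 => //; lra.
      have h3 : 0 <= (1 - s) * (r - x) by apply: mulr_ge0; lra.
      have h4 : 0 <= (1 - s) * (x + r) by apply: mulr_ge0; lra.
      apply/andP; split; lra.
    by apply: Bpt; exact: key.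
  apply/rowP => i; rewrite !mxE; case: ifP => _; ring.
have ivt u v u' v' u'' v'' : `|u| < r -> `|v| < r -> `|u'| < r -> `|v'| < r ->
    `|u''| < r -> `|v''| < r -> h (pt u v) <= h (pt u'' v'') <= h (pt u' v') ->
    exists s : R, u'' = u + s * (u' - u) /\ v'' = v + s * (v' - v).
  move=> ur vr u'r v'r u''r v''r hh.
  pose k s := pt u v + s *: (pt u' v' - pt u v).
  have ck : {within `[0, 1], continuous (h \o k)}.
    apply: continuous_in_subspaceT => s; rewrite inE /= in_itv /= => s01.
    apply: continuous_comp; first exact: segment_path_continuous.
    move: ch; rewrite continuous_open_subspace // => ch; apply: ch.
    by rewrite inE; exact: Bseg.
  have [||s] := @IVT R (h \o k) 0 1 (h (pt u'' v'')) _ ck; first exact: ler01.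
    have -> : (h \o k) 0 = h (pt u v) by rewrite /= /k scale0r addr0.
    have -> : (h \o k) 1 = h (pt u' v') by rewrite /= /k scale1r addrC subrK.
    by case/andP: hh => h1 h2; rewrite ge_min h1 le_max h2 orbT.
  rewrite in_itv /= => s01 /ih hk; exists s.
  have {}hk : k s = pt u'' v'' by apply: hk; [exact: Bseg|exact: Bpt].
  have := congr1 (fun M : 'rV_2 => M 0 0) hk.
  have := congr1 (fun M : 'rV_2 => M 0 1) hk.
  rewrite /k !mxE /= => e1 e2; split; lra.
have n0 : `|0 : R| < r by rewrite normr0.
have n1 : `|r / 2| < r by rewrite gtr0_norm //; lra.
have H (a b c' d a' b' : R) := @ivt a b c' d a' b'.
have [h1|h1] := leP (h (pt 0 0)) (h (pt (r/2) 0));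
have [h2|h2] := leP (h (pt 0 0)) (h (pt 0 (r/2)));
have [h3|h3] := leP (h (pt (r/2) 0)) (h (pt 0 (r/2))).
- have [|s [e1 e2]] := H 0 0 0 (r/2) (r/2) 0 n0 n0 n0 n1 n1 n0; [exact/andP|nra].
- have [|s [e1 e2]] := H 0 0 (r/2) 0 0 (r/2) n0 n0 n1 n0 n0 n1; [by rewrite h2 ltW|nra].
- lra.
- have [|s [e1 e2]] := H 0 (r/2) (r/2) 0 0 0 n0 n1 n1 n0 n0 n0; [by rewrite h1 ltW|nra].
- have [|s [e1 e2]] := H (r/2) 0 0 (r/2) 0 0 n1 n0 n0 n1 n0 n0; [by rewrite h2 ltW|nra].
- lra.
- have [|s [e1 e2]] := H (r/2) 0 0 0 0 (r/2) n1 n0 n0 n0 n0 n1; [by rewrite h3 ltW|nra].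
- have [|s [e1 e2]] := H 0 (r/2) 0 0 (r/2) 0 n0 n1 n0 n0 n1 n0; [by rewrite !ltW|nra].
Qed.

Lemma open_no_injection j (B : set 'rV[R]_2) (h : 'rV[R]_2 -> 'rV[R]_j) :
  (j < 2)%N -> open B -> B !=set0 -> {within B, continuous h} ->
  (forall x y, B x -> B y -> h x = h y -> x = y) -> False.
Proof.
move=> j2 oB B0 ch ih.
case: j j2 h ch ih => [|[|//]] _ h ch ih.
  apply: (@open_no_injection_line B (fun=> 0)) => //.
    by apply: continuous_subspaceT; exact: cst_continuous.
  by move=> x y Bx By _; apply: ih => //; apply/rowP => -[].
apply: (@open_no_injection_line B (fun x => h x 0 0)) => //.
  apply: (@within_continuous_comp _ _ _ B h (fun M : 'rV_1 => M 0 0)) => //.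
  by move=> M _; exact: coord_continuous.
move=> x y Bx By e; apply: ih => //; apply/rowP => i.
by rewrite (ord1 i).
Qed.

Lemma sumsq_continuous n : continuous (fun x : 'rV[R]_n => \sum_i x 0 i ^+ 2).
Proof.
move=> x; have @F : Filter (nbhs x) := nbhs_filter x.
apply: cvg_big => [|i _]; first exact: add_continuous.
apply: (@cvg_comp _ _ _ (fun M : 'rV[R]_n => M 0 i) (fun y : R => y ^+ 2)).
  exact: coord_continuous.
exact: exprn_continuous.
Qed.

Lemma disk_compact n : compact (@disk R n).
Proof.
apply: (@subclosed_compact _ _
    [set v : 'rV[R]_n | forall i, `[(-1 : R), 1]%classic (v ord0 i)]).
- rewrite (_ : @disk R n = (fun x => \sum_i x 0 i ^+ 2) @^-1` [set y | y <= 1]) //.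
  apply: preimage_closed; first by move=> x _; exact: sumsq_continuous.
  exact: closed_le.
- by apply: (@rV_compact R n (fun=> `[(-1 : R), 1]%classic)) => i; exact: segment_compact.
- move=> v dv i /=; rewrite in_itv /=.
  have : v 0 i ^+ 2 <= 1.
    apply: le_trans dv; rewrite (bigD1 i) //= lerDl.
    by apply: sumr_ge0 => *; exact: sqr_ge0.
  by nra.
Qed.

Lemma sphere_closed n : closed (@sphere R n).
Proof.
rewrite (_ : @sphere R n = (fun x => \sum_i x 0 i ^+ 2) @^-1` [set 1]) //.
apply: preimage_closed; first by move=> x _; exact: sumsq_continuous.
exact: closed_eq.
Qed.

Lemma open_disk_open n : open (@open_disk R n).
Proof.
rewrite (_ : @open_disk R n = (fun x => \sum_i x 0 i ^+ 2) @^-1` [set y | y < 1]) //.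
by apply: open_comp; [move=> x _; exact: sumsq_continuous|exact: open_lt].
Qed.

Lemma open_disk0 n : (@open_disk R n) 0.
Proof. by rewrite /open_disk /= big1 // => i _; rewrite mxE expr0n. Qed.

Lemma open_disk_connected n : connected (@open_disk R n).
Proof.
apply: (@star_shaped_connected n _ 0) => q s dq /andP[s0 s1].
rewrite add0r subr0 /open_disk /=; apply: le_lt_trans dq.
apply: ler_sum => i _; rewrite mxE exprMn ler_piMl ?sqr_ge0 //.
exact: exprn_ile1.
Qed.

End Planar.

(** * Two-dimensional CW complexes and their structure maps *)

Lemma within_comp (T U V : topologicalType) (A : set T) (B : set U)
    (f : T -> U) (g : U -> V) :
  {within A, continuous f} -> (forall x, A x -> B (f x)) ->
  {within B, continuous g} -> {within A, continuous (g \o f)}.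
Proof.
move=> /subspace_continuousP cf fAB /subspace_continuousP cg.
apply/subspace_continuousP => x Ax W nW.
have := cf x Ax _ (cg _ (fAB _ Ax) _ nW).
rewrite !nbhs_simpl /= /within /=.
by apply: filterS => z + Az; move=> /(_ Az (fAB _ Az)).
Qed.

Section Homeo.
Variables (T U : topologicalType) (f : T -> U) (A : set T) (B : set U).
Hypothesis fAB : homeo_on f A B.

Lemma homeo_image : f @` A = B.
Proof.
case: fAB => _ [g [_ fA gB]]; apply/seteqP; split.
  by move=> _ [x Ax <-]; case: (fA x Ax).
by move=> y By; case: (gB y By) => ? ?; exists (g y).
Qed.

Lemma homeo_inj x y : A x -> A y -> f x = f y -> x = y.
Proof.
case: fAB => _ [g [_ fA gB]] Ax Ay e.
by have [_ <-] := fA x Ax; have [_ <-] := fA y Ay; rewrite e.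
Qed.
End Homeo.

Section CW.
Variables (R : realType) (T : topologicalType) (C : cellulation T).
Hypothesis cw : is_CW2 R C.

Lemma cw_hausdorff : hausdorff_space T. Proof. by case: cw. Qed.

Lemma cell_dim k e : C k e -> (k <= 2)%N. Proof. by case: cw => _ _ + _ _; apply. Qed.

Lemma cell_cover x : exists k e, C k e /\ e x.
Proof. by case: cw => _ [] + _ _ _ _; apply. Qed.

Lemma cell_uniq k j e e' x : C k e -> C j e' -> e x -> e' x -> k = j /\ e = e'.
Proof. by case: cw => _ [] _ + _ _ _ => + Ce Ce' ex e'x; apply => //; exists x. Qed.

Lemma cell_char k e : C k e -> exists chi : 'rV[R]_k -> T, characteristic_map C e chi.
Proof. by case: cw => _ _ _ + _; apply. Qed.

Lemma cell_nonempty k e : C k e -> e !=set0.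
Proof.
move=> /cell_char[chi [_ hchi _]]; exists (chi 0).
by rewrite -(homeo_image hchi); exists 0 => //; exact: open_disk0.
Qed.

Lemma cell_connected k e : C k e -> connected e.
Proof.
move=> /cell_char[chi [_ hchi _]]; rewrite -(homeo_image hchi).
apply: connected_continuous_connected; first exact: open_disk_connected.
by case: hchi.
Qed.

(** The last clause expresses that the frontier of the cell is closed, being cut
    out of the closure by the image of the boundary sphere. *)
Lemma cell_closure k e : C k e -> exists D, [/\ finite_set D,
  (forall e', D e' -> exists2 j, (j < k)%N & C j e'),
  closure e `<=` e `|` \bigcup_(e' in D) e',
  compact (closure e) & exists2 B, closed B & closure e `\` e = closure e `&` B].
Proof.
move=> Ce; have [chi [cchi hchi [D [fD DC sD]]]] := cell_char Ce; exists D.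
have cdisk : compact (chi @` @disk R k).
  by apply: continuous_compact => //; exact: disk_compact.
have clE : closure e `<=` chi @` @disk R k.
  rewrite [X in _ `<=` X](closure_id _).1; last exact: (compact_closed cw_hausdorff cdisk).
  apply: closureS; rewrite -(homeo_image hchi) => _ [x dx <-]; exists x => //.
  exact: ltW.
have disk_split x : @disk R k x -> @open_disk R k x \/ @sphere R k x.
  by rewrite /disk /open_disk /sphere /= le_eqVlt => /orP[/eqP|]; [right|left].
have nsE x : (chi @` @sphere R k) x -> ~ e x.
  move=> /sD [e' De' e'x] ex; have [j jk Ce'] := DC _ De'.
  by have [kj _] := cell_uniq Ce Ce' ex e'x; rewrite kj ltnn in jk.
have clE' x : closure e x -> e x \/ (chi @` @sphere R k) x.
  move=> /clE[u /disk_split[du|du] <-]; [left|right; by exists u].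
  by rewrite -(homeo_image hchi); exists u.
split => //.
- by move=> x /clE'[ex|/sD]; [left|right].
- by apply: subclosed_compact cdisk _ => //; exact: closed_closure.
- exists (chi @` @sphere R k).
    apply: (compact_closed cw_hausdorff); apply: continuous_compact.
      by apply: continuous_subspaceW cchi => x; rewrite /sphere /disk /= => ->.
    apply: (subclosed_compact (@sphere_closed R k) (@disk_compact R k)).
    by move=> x; rewrite /sphere /disk /= => ->.
  apply/seteqP; split=> x [clx ex]; split => //; last exact: nsE.
  by case: (clE' _ clx).
Qed.

Lemma closure_cell_compact k e : C k e -> compact (closure e).
Proof. by move=> /cell_closure[D []]. Qed.

Lemma closure_meets_2cell k e e' x :
  C k e -> C 2%N e' -> closure e x -> e' x -> e = e'.
Proof.
move=> Ce Ce' clx e'x; have [D [_ DC sD _ _]] := cell_closure Ce.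
have [ex|[d Dd dx]] := sD _ clx; first by case: (cell_uniq Ce Ce' ex e'x).
have [j jk Cd] := DC _ Dd; have [j2 _] := cell_uniq Cd Ce' dx e'x.
by have := cell_dim Ce; rewrite leqNgt -j2 jk.
Qed.

Lemma two_cell_open e : C 2%N e -> open e.
Proof.
move=> Ce; rewrite -[e]setCK; apply: closed_openC.
have [_ _ _ _ wk] := cw; apply: wk => k e' Ce'.
have [->|ee'] := pselect (e' = e).
  have [_ [_ _ _ _ [B cB eB]]] := cell_closure Ce.
  rewrite setIC -setDE eB; apply: closedI => //; exact: closed_closure.
rewrite (_ : _ `&` _ = closure e'); first exact: closed_closure.
apply/seteqP; split=> x; first by case.
by move=> clx; split => // ex; apply: ee'; exact: (closure_meets_2cell Ce' Ce clx ex).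
Qed.

(** Choosing one point in each 2-cell gives a set that meets each closed cell in
    at most one point, so all its subsets are closed by the weak topology. *)
Lemma finite_2cells_meeting (K : set T) : compact K ->
  finite_set [set e | C 2%N e /\ e `&` K !=set0].
Proof.
move=> cK; set E := [set e | _].
have [[x0 Kx0]|K0] := pselect (K !=set0); last first.
  rewrite (_ : E = set0) //; apply/seteqP; split=> // e [_ [x [_ Kx]]].
  by apply: K0; exists x.
have /choice[p hp] (e : set T) : exists x, E e -> e x /\ K x.
  by have [[_ [x [ex Kx]]]|nE] := pselect (E e); [exists x|exists x0].
have pinj e e' x : E e -> E e' -> e' x -> x = p e -> e = e' .
  move=> Ee Ee' e'x xe; have [pe _] := hp _ Ee.
  by rewrite -xe in pe; case: (cell_uniq Ee.1 Ee'.1 pe e'x).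
have fA : finite_set (p @` E).
  apply: (compact_discrete_finite cK).
    by move=> _ [e Ee <-]; case: (hp _ Ee).
  move=> B BE; have [_ _ _ _ wk] := cw; apply: wk => k e' Ce'.
  move: (cw_hausdorff) => /hausdorff_accessible/accessible_finite_set_closed; apply.
  apply: sub_finite_set (finite_set1 (p e')) => x [Bx clx].
  have [e Ee ex] := BE _ Bx; rewrite -ex in clx *.
  have [pe _] := hp _ Ee.
  by rewrite (closure_meets_2cell Ce' Ee.1 clx pe).
apply: (sub_finite_set _ (finite_image
  (fun x => [set z | exists2 e, C 2%N e & e x /\ e z]) fA)).
move=> e Ee; exists (p e); first by exists e.
have [pe _] := hp _ Ee.
apply/seteqP; split=> z; last by move=> ez; exists e => //; case: Ee.
by move=> [e' Ce' [e'p e'z]]; have [_ ->] := cell_uniq Ee.1 Ce' pe e'p.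
Qed.

End CW.

(** Invariance of dimension, in the only cases that occur in a 2-complex: a
    planar region does not inject into a line, nor an interval into a point. *)
Lemma homeo_cell_dim (R : realType) (T U : topologicalType)
    (C : cellulation T) (D : cellulation U) (f : T -> U) k j e d :
  is_CW2 R C -> is_CW2 R D -> C k e -> D j d ->
  {within e, continuous f} -> (forall x, e x -> d (f x)) ->
  (forall x y, e x -> e y -> f x = f y -> x = y) -> (k <= j)%N.
Proof.
move=> cwC cwD Ce Dd cf fed fi; rewrite leqNgt; apply/negP => jk.
have [chi [_ hchi _]] := cell_char cwC Ce.
have [psi [_ hpsi _]] := cell_char cwD Dd.
have [cpsi [pg [cpg psiA pgB]]] := hpsi.
have chie x : @open_disk R k x -> e (chi x).
  by move=> dx; rewrite -(homeo_image hchi); exists x.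
pose h := pg \o (f \o chi).
have ch : {within @open_disk R k, continuous h}.
  apply: (within_comp (B := d)) => //; last by move=> x dx; apply/fed/chie.
  by apply: (within_comp (B := e)) => //; case: hchi.
have hi x y : @open_disk R k x -> @open_disk R k y -> h x = h y -> x = y.
  move=> dx dy /(congr1 psi); rewrite /h /=.
  rewrite (pgB _ (fed _ (chie _ dx))).2 (pgB _ (fed _ (chie _ dy))).2.
  by move=> /(fi _ _ (chie _ dx) (chie _ dy)); exact: (homeo_inj hchi).
have : (k <= 2)%N by exact: cell_dim cwC _ _ Ce.
rewrite leq_eqVlt => /orP[/eqP k2|k2].
  move: chi hchi chie h ch hi jk; rewrite k2 => chi hchi chie h ch hi j2.
  apply: (open_no_injection j2 (@open_disk_open R 2)) ch hi.
  by exists 0; exact: open_disk0.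
have /eqP k1 : k == 1%N by move: jk k2; clear; case: k => [|[|]].
have j0 : j = 0%N by move: jk; rewrite k1; clear; case: j.
(* an open interval has two points *)
pose u : 'rV[R]_k := const_mx (1 / 2).
have du : @open_disk R k u.
  rewrite /open_disk /= /u k1 big_ord1 mxE; lra.
have : 0 = u.
  apply: hi => //; first exact: open_disk0.
  by move: (h 0) (h u); rewrite j0 => a b; apply/rowP => -[].
have lt0k : (0 < k)%N by rewrite k1.
move=> /rowP/(_ (Ordinal lt0k)); rewrite !mxE; lra.
Qed.

Section StructureMap.
Variables (R : realType) (T U : topologicalType).
Variables (C : cellulation T) (D : cellulation U) (f : T -> U).
Hypotheses (cwC : is_CW2 R C) (cwD : is_CW2 R D) (sm : structure_map C D f).

Lemma structure_map_cell k e : C k e -> D k (f @` e) /\ homeo_on f e (f @` e).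
Proof.
case: sm => _ sk + Ce => /(_ _ _ Ce)[j [d [Dd hd]]].
have ed := homeo_image hd; rewrite ed; split => //.
have kj : (k <= j)%N.
  apply: (homeo_cell_dim cwC cwD Ce Dd); first by case: hd.
    by move=> x ex; rewrite -ed; exists x.
  exact: homeo_inj hd.
have jk : (j <= k)%N.
  have [x ex] := cell_nonempty cwC Ce.
  have [|i [d' [ik Dd' d'x]]] := sk k (f x).
    by exists x => //; exists k, e.
  have dfx : d (f x) by rewrite -ed; exists x.
  by have [<- _] := cell_uniq cwD Dd' Dd d'x dfx.
by have /eqP -> : k == j by rewrite eqn_leq kj jk.
Qed.

Lemma structure_map_lift k d x : D k d -> d (f x) ->
  exists e, [/\ C k e, e x & f @` e = d].
Proof.
move=> Dd dfx; have [j [e [Ce ex]]] := cell_cover cwC x.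
have [De _] := structure_map_cell Ce.
have [jk ed] := cell_uniq cwD De Dd (imageP _ ex) dfx.
by exists e; split => //; rewrite -jk.
Qed.

(** The 2-cells over [d] are open and disjoint, and they cover the preimage of
    [d]. *)
Lemma structure_map_2cell_lift (Q : set T) d : connected Q -> Q !=set0 ->
  D 2%N d -> (forall x, Q x -> d (f x)) ->
  exists e, [/\ C 2%N e, Q `<=` e & f @` e = d].
Proof.
move=> cQ Q0 Dd Qd.
have [|||e [Ce fe] Qe] :=
  connected_sub_open (D := [set e | C 2%N e /\ f @` e = d]) cQ Q0.
- by move=> e [Ce _]; exact: two_cell_open cwC _ Ce.
- by move=> e e' [Ce _] [Ce' _] [x [ex e'x]]; case: (cell_uniq cwC Ce Ce' ex e'x).
- by move=> x /Qd /(structure_map_lift Dd)[e [Ce ex fe]]; exists e.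
by exists e; split.
Qed.

Lemma structure_map_closure_cell k e : C k e -> forall j d, D j d ->
  (j = k) -> closure e `&` f @^-1` d `<=` e.
Proof.
move=> Ce j d Dd jk x [clx dx].
have [E [_ EC sE _ _]] := cell_closure cwC Ce.
have [//|[e' Ee' e'x]] := sE _ clx.
have [i ik Ce'] := EC _ Ee'; have [De' _] := structure_map_cell Ce'.
have [ij _] := cell_uniq cwD De' Dd (imageP _ e'x) dx.
by move: ik; rewrite ij jk ltnn.
Qed.

End StructureMap.

(** * Convex sets and the regular polygon *)

Section Convex.
Variables (R : realType) (n : nat) (A : set 'rV[R]_n).
Hypothesis cvxA : forall x y (s : R), A x -> A y -> 0 <= s <= 1 ->
  A (x + s *: (y - x)).

(** The homothety of centre [p] and ratio [s] maps a ball around [q] inside [A] to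
    a ball inside [A]. *)
Lemma interior_segment p q (s : R) : A p -> A° q -> 0 < s <= 1 ->
  A° (p + s *: (q - p)).
Proof.
move=> Ap /nbhs_ballP[r /= r0 rA] /andP[s0 s1].
apply/nbhs_ballP; exists (s * r) => /=; first exact: mulr_gt0.
move=> z; rewrite -ball_normE /= /ball_ /= => hz.
have -> : z = p + s *: ((q + s^-1 *: (z - (p + s *: (q - p)))) - p).
  rewrite [q + _ - p]addrAC scalerDr scalerA divff ?gt_eqF // scale1r.
  by rewrite addrA addrC subrK.
apply: cvxA => //; last by rewrite (ltW s0).
apply: rA; rewrite -ball_normE /= /ball_ /=.
rewrite opprD addNKr normrN normrZ gtr0_norm ?invr_gt0 //.
by rewrite ltr_pdivrMl // distrC.
Qed.

Lemma convex_interior x y (s : R) : A° x -> A° y -> 0 <= s <= 1 ->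
  A° (x + s *: (y - x)).
Proof.
move=> Ax Ay /andP[]; rewrite le_eqVlt => /orP[/eqP <- _|s0 s1].
  by rewrite scale0r addr0.
by apply: interior_segment => //; [exact: interior_subset|rewrite s0].
Qed.

Lemma ball_convex (c x y : 'rV[R]_n) (r s : R) : ball c r x -> ball c r y ->
  0 <= s <= 1 -> ball c r (x + s *: (y - x)).
Proof.
rewrite -!ball_normE /= /ball_ /= => cx cy /andP[s0 s1].
have -> : c - (x + s *: (y - x)) = (1 - s) *: (c - x) + s *: (c - y).
  by apply/rowP => i; rewrite !mxE; ring.
apply: le_lt_trans (ler_normD _ _) _; rewrite !normrZ.
rewrite ger0_norm ?subr_ge0 // (ger0_norm s0).
have [->|sn0] := eqVneq s 0; first by rewrite mul0r addr0 subr0 mul1r.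
have sp : 0 < s by rewrite lt0r sn0.
have h1 : 0 < s * (r - `|c - y|) by apply: mulr_gt0 => //; lra.
have h2 : 0 <= (1 - s) * (r - `|c - x|) by apply: mulr_ge0; lra.
lra.
Qed.

Lemma ball_interior_connected c (r : R) : connected (ball c r `&` A°).
Proof.
have [[p [cp Ap]]|n0] := pselect ((ball c r `&` A°) !=set0); last first.
  have -> : ball c r `&` A° = set0.
    by apply/seteqP; split=> z // Az; case: n0; exists z.
  exact: connected0.
apply: (@star_shaped_connected R n _ p) => q s [cq Aq] s01.
by split; [exact: ball_convex|exact: convex_interior].
Qed.

Lemma interior_dense p (V : set 'rV[R]_n) : A° !=set0 -> A p -> nbhs p V ->
  V `&` A° !=set0.
Proof.
move=> [q Aq] Ap nV.
have := @segment_path_continuous R n p q 0.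
move=> /(_ V); rewrite scale0r addr0 => /(_ nV); rewrite nbhs_simpl /=.
move=> /nbhs_ballP[e /= e0 eV].
pose s := Num.min (e / 2) 1.
have s0 : 0 < s by rewrite /s lt_min ltr01 divr_gt0.
exists (p + s *: (q - p)); split.
  apply: eV; rewrite /ball /= sub0r normrN gtr0_norm //.
  by rewrite /s gt_min; apply/orP; left; lra.
by apply: interior_segment => //; rewrite s0 /= /s ge_min lexx orbT.
Qed.

End Convex.

Section Polygon.
Variables (R : realType) (m : nat).
Hypothesis m3 : (3 <= m)%N.
Let th : R := pi / m%:R.
Let v := @polygon_vertex R m.

Let m0 : (0 : R) < m%:R. Proof. by rewrite ltr0n; case: m m3. Qed.
Let th0 : 0 < th. Proof. by rewrite /th divr_gt0 // pi_gt0. Qed.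
Let mth : m%:R * th = pi. Proof. by rewrite /th mulrC divfK // gt_eqF. Qed.
Let th3 : 3 * th <= pi.
Proof. by rewrite -mth ler_wpM2r ?(ltW th0) // ler_nat. Qed.

Let v0 i : v i 0 0 = cos (i.*2%:R * th).
Proof.
rewrite /v /polygon_vertex mxE /=; congr cos.
by rewrite -muln2 natrM /th; field; rewrite gt_eqF.
Qed.
Let v1 i : v i 0 1 = sin (i.*2%:R * th).
Proof.
rewrite /v /polygon_vertex mxE /=; congr sin.
by rewrite -muln2 natrM /th; field; rewrite gt_eqF.
Qed.

Let rowP2 (x y : 'rV[R]_2) : x 0 0 = y 0 0 -> x 0 1 = y 0 1 -> x = y.
Proof.
move=> e0 e1; apply/rowP => -[[|[|//]] h].
  by rewrite (_ : Ordinal h = 0) //; exact/val_inj.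
by rewrite (_ : Ordinal h = 1) //; exact/val_inj.
Qed.

Lemma polygon_vertexD i : v (i + m) = v i.
Proof.
have e : (i + m).*2%:R * th = i.*2%:R * th + pi *+ 2.
  by rewrite doubleD natrD mulrDl -[m.*2]muln2 natrM mulrAC mth mulr_natr.
by apply: rowP2; rewrite ?v0 ?v1 e; [exact: cosD2pi|exact: sinD2pi].
Qed.

Lemma polygon_vertex_mod i : v (i %% m) = v i.
Proof.
rewrite {2}(divn_eq i m) addnC; elim: (i %/ m)%N => [|q IH].
  by rewrite mul0n addn0.
by rewrite mulSn [(m + _)%N]addnC addnA polygon_vertexD.
Qed.

(** The linear form whose value at the vertices is largest, equal to
    [cos (pi / m)], at the two ends of side [k]. *)
Definition side_fun k (x : 'rV[R]_2) : R :=
  x 0 0 * cos (k.*2.+1%:R * th) + x 0 1 * sin (k.*2.+1%:R * th).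

Lemma side_funD k x y : side_fun k (x + y) = side_fun k x + side_fun k y.
Proof. rewrite /side_fun !mxE; ring. Qed.
Lemma side_funZ k a x : side_fun k (a *: x) = a * side_fun k x.
Proof. rewrite /side_fun !mxE; ring. Qed.
Lemma side_fun0 k : side_fun k 0 = 0.
Proof. by rewrite /side_fun !mxE !mul0r addr0. Qed.
Lemma side_fun_sum k (w : 'I_m -> R) :
  side_fun k (\sum_i w i *: v i) = \sum_i w i * side_fun k (v i).
Proof.
elim/big_ind2: _ => [|? ? ? ? <- <-|i _]; first exact: side_fun0.
  exact: side_funD.
exact: side_funZ.
Qed.
Lemma side_fun_continuous k : continuous (side_fun k).
Proof.
move=> x; have FF : Filter (nbhs x) := nbhs_filter x.
by apply: (@cvgD _ _ _ _ FF); apply: (@cvgM _ _ _ FF);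
  [exact: coord_continuous|exact: cvg_cst..|exact: coord_continuous|exact: cvg_cst].
Qed.

(** The angles between the vertices and the normal of a side are the odd multiples
    of [pi / m]; those nearest to 0 modulo [2 * pi] belong to the two ends of the
    side. *)
Lemma cos_odd (r : nat) : (1 <= r)%N -> (r < m.*2)%N ->
  cos (r%:R * th) <= cos th /\
  (cos (r%:R * th) = cos th -> r = 1%N \/ r = m.*2.-1).
Proof.
move=> r1 r2m.
have key (b : R) : th <= b -> b <= pi -> cos b <= cos th /\ (cos b = cos th -> b = th).
  move=> tb bp.
  have h0 := th0; have h3 := th3.
  have thI : th \in `[0, pi] by rewrite in_itv /=; apply/andP; split; lra.
  have bI : b \in `[0, pi] by rewrite in_itv /=; apply/andP; split; lra.
  split; last by move=> /cos_inj; apply.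
  move: tb; rewrite le_eqVlt => /orP[/eqP -> //|tb].
  by apply: ltW; rewrite ltr_cos.
have thr : th <= r%:R * th by rewrite ler_peMl ?(ltW th0) // ler1n.
have [rp|rp] := leP (r%:R * th) pi.
  have [h1 h2] := key _ thr rp; split => // /h2 e; left.
  have /eqP : (r%:R - 1) * th = 0 by rewrite mulrBl e mul1r subrr.
  rewrite mulf_eq0 (gt_eqF th0) orbF subr_eq0.
  by rewrite (_ : 1 = 1%:R) // eqr_nat => /eqP.
have e : cos (r%:R * th) = cos ((m.*2 - r)%:R * th).
  have -> : (m.*2 - r)%:R * th = - (r%:R * th) + pi *+ 2.
    rewrite natrB; last exact: ltnW.
    by rewrite -[m.*2]muln2 natrM mulrBl mulrAC mth mulr_natr addrC.
  by rewrite (@cosD2pi R) cosN.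
have s1 : (1 <= m.*2 - r)%N by rewrite subn_gt0.
have ths : th <= (m.*2 - r)%:R * th by rewrite ler_peMl ?(ltW th0) // ler1n.
have sp : (m.*2 - r)%:R * th <= pi.
  rewrite natrB ?(ltnW r2m) // mulrBl -[m.*2]muln2 natrM mulrAC mth.
  have := rp; lra.
have [h1 h2] := key _ ths sp; rewrite e; split => // /h2 e'; right.
have /eqP : ((m.*2 - r)%:R - 1) * th = 0 by rewrite mulrBl e' mul1r subrr.
rewrite mulf_eq0 (gt_eqF th0) orbF subr_eq0.
rewrite (_ : 1 = 1%:R) // eqr_nat => /eqP e1.
by rewrite -(subKn (ltnW r2m)) e1 subn1.
Qed.

Lemma side_fun_vertex k i : (k < m)%N -> (i < m)%N ->
  side_fun k (v i) <= cos th /\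
  (side_fun k (v i) = cos th -> v i = v k \/ v i = v k.+1).
Proof.
move=> km im.
have -> : side_fun k (v i) = cos (i.*2%:R * th - k.*2.+1%:R * th).
  by rewrite /side_fun v0 v1 cosB.
have [ik|ki] := leqP i k.
  have -> : cos (i.*2%:R * th - k.*2.+1%:R * th) = cos ((k - i).*2.+1%:R * th).
    rewrite -cosN opprB -mulrBl -natrB; last by rewrite ltnW // ltnS leq_double.
    by rewrite subSn ?leq_double // -doubleB.
  have [|h1 h2] := @cos_odd (k - i).*2.+1 isT.
    by rewrite ltn_Sdouble; apply: leq_ltn_trans km; exact: leq_subr.
  split => // /h2[e|e].
    left; congr v; apply/eqP; rewrite eqn_leq ik /=.
    by move: e => [] /eqP; rewrite double_eq0 subn_eq0.
  right.
  have i0 : i = 0%N by lia.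
  have -> : k.+1 = m by lia.
  by rewrite i0 -[in RHS](add0n m) polygon_vertexD.
have -> : cos (i.*2%:R * th - k.*2.+1%:R * th) = cos ((i - k).*2.-1%:R * th).
  rewrite -mulrBl -natrB; last by rewrite ltn_double.
  by rewrite subnS -doubleB.
have [||h1 h2] := @cos_odd (i - k).*2.-1; [lia|lia|].
split => // /h2[e|e]; first by right; congr v; lia.
exfalso; lia.
Qed.

(** Both coordinate sums telescope after multiplication by [2 * sin (pi / m)]. *)
Lemma sum_vertices : \sum_(i < m) v i = 0.
Proof.
have sth : 0 < sin th.
  by apply: sin_gt0_pi; rewrite th0 /=; have := pi_gt0 R; have := th3; have := th0; lra.
have tel (k : nat) : sin th * ((\sum_(i < k) cos (i.*2%:R * th)) *+ 2) =
    sin (k.*2%:R * th - th) + sin th.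
  elim: k => [|k IH]; first by rewrite big_ord0 mul0r sub0r sinN mul0rn mulr0 addNr.
  rewrite big_ord_recr /= mulrnDl mulrDr IH.
  have -> : k.+1.*2%:R * th - th = k.*2%:R * th + th.
    by rewrite doubleS -addn2 natrD; ring.
  by rewrite sinB sinD; ring.
have tel' (k : nat) : sin th * ((\sum_(i < k) sin (i.*2%:R * th)) *+ 2) =
    cos th - cos (k.*2%:R * th - th).
  elim: k => [|k IH]; first by rewrite big_ord0 mul0r sub0r cosN mul0rn mulr0 subrr.
  rewrite big_ord_recr /= mulrnDl mulrDr IH.
  have -> : k.+1.*2%:R * th - th = k.*2%:R * th + th.
    by rewrite doubleS -addn2 natrD; ring.
  by rewrite cosB cosD; ring.
have e : m.*2%:R * th - th = - th + pi *+ 2.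
  by rewrite -[m.*2]muln2 natrM mulrAC mth addrC mulr_natr.
have c0 x : sin th * x *+ 2 = 0 -> x = 0.
  by move=> /eqP; rewrite mulrn_eq0 mulf_eq0 (gt_eqF sth) /= => /eqP.
apply: rowP2; rewrite summxE [RHS]mxE.
  under eq_bigr do rewrite v0.
  by apply: c0; rewrite -mulrnAr tel e (@sinD2pi R) sinN addNr.
under eq_bigr do rewrite v1.
by apply: c0; rewrite -mulrnAr tel' e (@cosD2pi R) cosN subrr.
Qed.

Lemma polygon_convex x y (s : R) : polygon R m x -> polygon R m y ->
  0 <= s <= 1 -> polygon R m (x + s *: (y - x)).
Proof.
move=> [w [w0 w1 ->]] [w' [w'0 w'1 ->]] /andP[s0 s1].
exists (fun i => (1 - s) * w i + s * w' i); split.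
- by move=> i; apply: addr_ge0; apply: mulr_ge0 => //; lra.
- by rewrite big_split /= -!mulr_sumr w1 w'1; lra.
- rewrite -sumrB scaler_sumr -big_split /=; apply: eq_bigr => i _.
  by apply/rowP => j; rewrite !mxE; ring.
Qed.

Lemma polygon_vertexP i : polygon R m (v i).
Proof.
have im : (i %% m < m)%N by rewrite ltn_mod; lia.
exists (fun j => (j == Ordinal im)%:R); split.
- by move=> j; case: eqP.
- by rewrite (bigD1 (Ordinal im)) //= eqxx big1 ?addr0 // => j /negbTE ->.
- rewrite (bigD1 (Ordinal im)) //= eqxx scale1r -/(v (i %% m)) polygon_vertex_mod big1 ?addr0 //.
  by move=> j /negbTE ->; rewrite scale0r.
Qed.

Lemma polygon0 : polygon R m 0.
Proof.
exists (fun=> m%:R^-1); split.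
- by move=> _; rewrite invr_ge0 ltW.
- by rewrite sumr_const card_ord -[LHS]mulr_natr mulVf // gt_eqF.
- by rewrite -scaler_sumr sum_vertices scaler0.
Qed.

Let cth : 0 < cos th.
Proof.
by apply: cos_gt0_pihalf; have := th3; have := pi_gt0 R; have := th0 => *;
  apply/andP; split; lra.
Qed.

(** For the reverse inclusion, [y] must be written with the two vertices of a
    sector containing it.  The cross products of [y] with the vertices, taken
    cyclically, add up to zero, so somewhere they pass from nonnegative to
    nonpositive; this is the sector, and Cramer's rule gives the coefficients. *)
Lemma polygonE : polygon R m = [set x | forall k, (k < m)%N -> side_fun k x <= cos th].
Proof.
apply/seteqP; split => [_ [w [w0 w1 ->]] k km|y hy].
  rewrite side_fun_sum -[leRHS]mul1r -w1 mulr_suml; apply: ler_sum => i _.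
  by apply: ler_wpM2l => //; case: (side_fun_vertex km (ltn_ord i)).
pose c k := v k 0 0 * y 0 1 - v k 0 1 * y 0 0.
have csum : \sum_(k < m) c k = 0.
  rewrite sumrB -!mulr_suml.
  have := sum_vertices => /rowP e; have := e 0; have := e 1.
  by rewrite !summxE !mxE => -> ->; rewrite !mul0r subrr.
have cmod k : c (k %% m)%N = c k by rewrite /c polygon_vertex_mod.
have [k [km ck ck1]] : exists k, [/\ (k < m)%N, 0 <= c k & c k.+1 <= 0].
  apply: contrapT => nk.
  have step k : 0 <= c k -> 0 < c k.+1.
    move=> ck; rewrite ltNge; apply/negP => ck1; apply: nk; exists (k %% m)%N.
    split; [by rewrite ltn_mod; lia|by rewrite cmod|].
    by rewrite -cmod -addn1 modnDml addn1 cmod.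
  have [[k0 ck0]|neg] := pselect (exists k, 0 <= c k).
    have pos j : 0 < c (k0 + j.+1)%N.
      elim: j => [|j IH]; first by rewrite addn1; exact: step.
      by rewrite addnS; apply/step/ltW.
    have posk k : 0 < c k.
      have := pos (k + k0.+1 * m - k0).-1.
      have -> : (k0 + (k + k0.+1 * m - k0).-1.+1 = k0.+1 * m + k)%N by nia.
      by rewrite -cmod modnMDl cmod.
    suff : 0 < \sum_(k < m) c k by rewrite csum ltxx.
    have mpos : (0 < m)%N by lia.
    rewrite (bigD1 (Ordinal mpos)) //=; apply: ltr_pwDl => //.
    by apply: sumr_ge0 => i _; exact: ltW.
  have negk k : 0 < - c k.
    by rewrite oppr_gt0 ltNge; apply/negP => ck; apply: neg; exists k.
  suff : 0 < - \sum_(k < m) c k by rewrite csum oppr0 ltxx.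
  have mpos : (0 < m)%N by lia.
  rewrite -sumrN (bigD1 (Ordinal mpos)) //=; apply: ltr_pwDl => //.
  by apply: sumr_ge0 => i _; exact: ltW.
have s2 : 0 < sin (2 * th).
  by apply: sin_gt0_pi; have := th3; have := pi_gt0 R; have := th0 => *;
    apply/andP; split; lra.
have e2 : k.+1.*2%:R * th = k.*2%:R * th + 2 * th.
  by rewrite doubleS -addn2 natrD; ring.
have det : v k 0 0 * v k.+1 0 1 - v k 0 1 * v k.+1 0 0 = sin (2 * th).
  have -> : 2 * th = k.+1.*2%:R * th - k.*2%:R * th by rewrite e2; ring.
  by rewrite !v0 !v1 sinB; ring.
set s := sin (2 * th) in s2 det.
pose a := - c k.+1 / s; pose b := c k / s.
have a0 : 0 <= a by rewrite /a divr_ge0 // ?oppr_ge0 // ltW.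
have b0 : 0 <= b by rewrite /b divr_ge0 // ltW.
have yE : y = a *: v k + b *: v k.+1.
  have sn0 : s != 0 by rewrite gt_eqF.
  have cramer (p0 p1 q0 q1 y0 y1 d : R) : p0 * q1 - p1 * q0 = d -> d != 0 ->
      y0 = - (q0 * y1 - q1 * y0) / d * p0 + (p0 * y1 - p1 * y0) / d * q0 /\
      y1 = - (q0 * y1 - q1 * y0) / d * p1 + (p0 * y1 - p1 * y0) / d * q1.
    by move=> <- dn0; split; field.
  have [e0 e1] := cramer _ _ _ _ (y 0 0) (y 0 1) _ det sn0.
  by apply: rowP2; rewrite [RHS]mxE [X in X + _]mxE [X in _ + X]mxE.
have lk : side_fun k (v k) = cos th.
  rewrite /side_fun v0 v1 -cosB -cosN; congr cos.
  by rewrite -addn1 natrD; ring.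
have lk1 : side_fun k (v k.+1) = cos th.
  rewrite /side_fun v0 v1 -cosB; congr cos.
  by rewrite doubleS -addn2 -[k.*2.+1]addn1 !natrD; ring.
have ab1 : a + b <= 1.
  have := hy k km; rewrite yE side_funD !side_funZ lk lk1 -mulrDl.
  by rewrite -[leRHS]mul1r ler_pM2r.
have [ab0|abn0] := eqVneq (a + b) 0.
  have a00 : a = 0 by lra.
  have b00 : b = 0 by lra.
  by rewrite yE a00 b00 !scale0r addr0; exact: polygon0.
have ab0 : 0 < a + b by rewrite lt0r abn0 addr_ge0.
have -> : y = 0 + (a + b) *: ((v k + (b / (a + b)) *: (v k.+1 - v k)) - 0).
  rewrite yE add0r subr0; apply/rowP => j; rewrite !mxE; field.
  exact: abn0.
apply: polygon_convex; first exact: polygon0.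
  apply: polygon_convex; [exact: polygon_vertexP|exact: polygon_vertexP|].
  apply/andP; split; first by apply: divr_ge0 => //; exact: ltW.
  by rewrite ler_pdivrMr // mul1r lerDr.
by rewrite ab1 ltW.
Qed.

Lemma polygon_interior : [set x | forall k, (k < m)%N -> side_fun k x < cos th]
  `<=` (polygon R m)°.
Proof.
rewrite -open_subsetE; first by rewrite polygonE => x hx k km; rewrite ltW // hx.
rewrite (_ : [set _ | _] =
    ~` \bigcup_(k in `I_m) side_fun k @^-1` [set y | cos th <= y]).
  apply: closed_openC; apply: closed_bigcup => // k _.
  apply: preimage_closed; first by move=> x _; exact: side_fun_continuous.
  exact: closed_ge.
apply/seteqP; split=> [x hx [k km /=]|x hx k km]; first by rewrite leNgt hx.
by rewrite ltNge; apply/negP => ck; apply: hx; exists k.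
Qed.

Lemma polygon_interior_nonempty : (polygon R m)° !=set0.
Proof.
by exists 0; apply: polygon_interior => k _; rewrite side_fun0.
Qed.

(** A point of the polygon that is not interior maximizes some side form, so it
    is a combination of the two ends of that side alone. *)
Lemma polygon_cover x : polygon R m x -> [\/ (polygon R m)° x,
  exists2 i, (i < m)%N & polygon_edge m i x |
  exists2 i, (i < m)%N & x = v i].
Proof.
move=> Px; have [hx|] := pselect (forall k, (k < m)%N -> side_fun k x < cos th).
  by constructor 1; exact: polygon_interior.
move=> /existsNP[k /not_implyP[km /negP]]; rewrite -leNgt => kx.
have {}kx : side_fun k x = cos th.
  apply/eqP; rewrite eq_le kx andbT; move: Px; rewrite polygonE.
  by apply.
case: Px kx => w [w0 w1 ->]; rewrite side_fun_sum => kx.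
have wE (i : 'I_m) : w i *: v i =
    w i *: v k + (if v i == v k.+1 then w i else 0) *: (v k.+1 - v k).
  have [->|vk1] := eqVneq (v i) (v k.+1).
    by rewrite scalerBr addrC subrK.
  rewrite scale0r addr0.
  have /eqP : w i * (cos th - side_fun k (v i)) = 0.
    have /psumr_eq0P : \sum_i w i * (cos th - side_fun k (v i)) = 0.
      under eq_bigr do rewrite mulrBr.
      by rewrite sumrB -mulr_suml w1 mul1r kx subrr.
    apply => // j _; apply: mulr_ge0 => //; rewrite subr_ge0.
    by case: (side_fun_vertex km (ltn_ord j)).
  rewrite mulf_eq0 => /orP[/eqP ->|]; first by rewrite !scale0r.
  rewrite subr_eq0 => /eqP/esym /(side_fun_vertex km (ltn_ord i)).2[->//|e].
  by rewrite e eqxx in vk1.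
pose t := \sum_i (if v (i : 'I_m) == v k.+1 then w i else 0).
have -> : \sum_i w i *: v i = v k + t *: (v k.+1 - v k).
  under eq_bigr do rewrite wE.
  by rewrite big_split /= -!scaler_suml w1 scale1r.
have t0 : 0 <= t by apply: sumr_ge0 => i _; case: ifP.
have t1 : t <= 1 by rewrite -w1; apply: ler_sum => i _; case: ifP.
move: t0; rewrite le_eqVlt => /orP[/eqP <-|t0].
  by constructor 3; exists k => //; rewrite scale0r addr0.
move: t1; rewrite le_eqVlt => /orP[/eqP ->|t1].
  constructor 3; exists (k.+1 %% m)%N; first by rewrite ltn_mod; lia.
  by rewrite scale1r addrC subrK polygon_vertex_mod.
constructor 2; exists k => //; exists t; split => //.
by apply/rowP => j; rewrite !mxE; ring.
Qed.

Lemma polygon_compact : compact (polygon R m).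
Proof.
apply: (@subclosed_compact _ _
    [set x : 'rV[R]_2 | forall i, `[(-1 : R), 1]%classic (x ord0 i)]).
- rewrite polygonE (_ : [set _ | _] =
    \bigcap_(k in `I_m) side_fun k @^-1` [set y | y <= cos th]) //.
  apply: closed_bigI => k _.
  apply: preimage_closed; first by move=> x _; exact: side_fun_continuous.
  exact: closed_le.
- by apply: (@rV_compact R 2 (fun=> `[(-1 : R), 1]%classic)) => i; exact: segment_compact.
- move=> _ [w [w0 w1 ->]] j /=; rewrite in_itv /= -ler_norml summxE.
  apply: le_trans (ler_norm_sum _ _ _) _; rewrite -w1; apply: ler_sum => i _.
  rewrite mxE normrM ger0_norm // ler_piMr // mxE.
  by case: ifP => _; [exact: cos_max|exact: sin_max].
Qed.

End Polygon.

(** * Tile types and the tiles modelled on them *)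

Section SetType.
Variables (X : topologicalType) (A : set X).

(** A map from the whole space, continuous within [A], through which compactness
    and connectedness of subsets of [A] pass to the subtype. *)
Definition to_set_type (x0 : A) (x : X) : A :=
  if pselect (A x) is left Ax then exist _ x (mem_set Ax) else x0.

Lemma to_set_typeK (x0 : A) (x : A) : to_set_type x0 (set_val x) = x.
Proof.
rewrite /to_set_type; case: pselect => [Ax|nA]; first exact: val_inj.
by exfalso; apply: nA; exact: set_valP.
Qed.

Lemma set_val_to_set_type (x0 : A) x : A x -> set_val (to_set_type x0 x) = x.
Proof. by rewrite /to_set_type; case: pselect. Qed.

Lemma to_set_type_continuous (x0 : A) : {within A, continuous (to_set_type x0)}.
Proof.
apply/subspace_sigL_continuousP.
rewrite (_ : sigL A (to_set_type x0) = id); first by move=> x.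
by apply/funext => x; exact: to_set_typeK.
Qed.

Lemma to_set_type_image (x0 : A) (B : set X) : B `<=` A ->
  to_set_type x0 @` B = set_val @^-1` B.
Proof.
move=> BA; apply/seteqP; split=> [_ [x Bx <-]|x Bx].
  by rewrite /preimage /= set_val_to_set_type //; exact: BA.
by exists (set_val x) => //; exact: to_set_typeK.
Qed.

Lemma set_type_compact : compact A -> compact [set: A].
Proof.
move=> cA; have [[x0 _]|n0] := pselect ([set: A] !=set0); last first.
  have -> : [set: A] = set0.
    by apply/seteqP; split=> z // _; apply: n0; exists z.
  exact: compact0.
have -> : [set: A] = to_set_type x0 @` A.
  rewrite to_set_type_image //; apply/seteqP; split=> // x _.
  exact: set_valP.
by apply: continuous_compact => //; exact: to_set_type_continuous.
Qed.

Lemma set_val_continuous : continuous (set_val : A -> X).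
Proof. exact: initial_continuous. Qed.

Lemma set_type_hausdorff : hausdorff_space X -> hausdorff_space A.
Proof.
move=> hX p q pq; apply: val_inj; apply: hX => U V nU nV.
have [z [Uz Vz]] := pq _ _ (set_val_continuous nU) (set_val_continuous nV).
by exists (set_val z).
Qed.

Lemma set_type_connected (B : set X) : B `<=` A -> connected B ->
  connected (set_val @^-1` B : set A).
Proof.
move=> BA cB; have [[x Bx]|n0] := pselect (B !=set0); last first.
  have -> : (set_val @^-1` B : set A) = set0.
    by apply/seteqP; split=> z // Bz; apply: n0; exists (set_val z).
  exact: connected0.
rewrite -(to_set_type_image (exist _ x (mem_set (BA _ Bx)))) //.
apply: connected_continuous_connected => //.
by apply: (continuous_subspaceW BA); exact: to_set_type_continuous.
Qed.

Lemma set_type_nbhs (p : A) (V : set A) : nbhs p V ->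
  exists2 W : set X, nbhs (set_val p) W & set_val @^-1` W `<=` V.
Proof.
rewrite nbhsE => -[U [oU Up] UV]; case: oU => W oW WU; exists W.
  by exists W => //; split => //; move: Up; rewrite -WU.
by rewrite WU.
Qed.

End SetType.

Lemma finite_fiber (K Y : Type) (g : K -> Y) (T : set K) (D : set (set K)) y :
  finite_set D -> T `<=` \bigcup_(A in D) A ->
  (forall A, D A -> forall x x', A x -> A x' -> g x = g x' -> x = x') ->
  finite_set (T `&` g @^-1` [set y]).
Proof.
move=> fD TD gi.
apply: (@sub_finite_set _ _ (\bigcup_(A in D) (A `&` g @^-1` [set y]))).
  by move=> x [/TD[A DA Ax] gx]; exists A.
apply: bigcup_finite => // A DA.
have [[x [Ax gx]]|n0] := pselect ((A `&` g @^-1` [set y]) !=set0).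
  apply: sub_finite_set (finite_set1 x) => z [Az gz] /=.
  by apply: (gi A) => //; rewrite gx gz.
by apply: sub_finite_set (finite_set0 _) => z Az; apply: n0; exists z.
Qed.

Section PolygonPieces.
Variables (R : realType) (m : nat).
Hypothesis m3 : (3 <= m)%N.
Local Notation P := (polygon R m).

Definition polygon_pieces : set (set P) :=
  [set A | exists k, polygon_cells R m k A].

Definition polygon_face : set P := set_val @^-1` P°.

Lemma polygon_pieces_finite : finite_set polygon_pieces.
Proof.
apply: (@sub_finite_set _ _ ([set polygon_face] `|`
  ((fun i => set_val @^-1` polygon_edge m i : set P) @` `I_m `|`
   (fun i => set_val @^-1` [set @polygon_vertex R m i] : set P) @` `I_m))).
  move=> A [[|[|[|//]]]] /=.
  - by move=> [i im ->]; right; right; exists i.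
  - by move=> [i im ->]; right; left; exists i.
  - by move=> ->; left.
rewrite !finite_setU; split => //; split; exact: finite_image.
Qed.

Lemma polygon_pieces_cover p : exists2 A, polygon_pieces A & A p.
Proof.
have [Pp|[i im ep]|[i im ep]] := polygon_cover m3 (set_valP p).
- by exists polygon_face => //; exists 2%N.
- by exists (set_val @^-1` polygon_edge m i) => //; exists 1%N, i.
- by exists (set_val @^-1` [set polygon_vertex R m i]) => //; exists 0%N, i.
Qed.

Lemma polygon_edge_sub i : @polygon_edge R m i `<=` P.
Proof.
move=> x [s [s0 s1 ->]].
have -> : (1 - s) *: polygon_vertex R m i + s *: polygon_vertex R m i.+1 =
   polygon_vertex R m i + s *: (polygon_vertex R m i.+1 - polygon_vertex R m i).
  by apply/rowP => j; rewrite !mxE; ring.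
apply: polygon_convex; [exact: polygon_vertexP|exact: polygon_vertexP|].
by rewrite !ltW.
Qed.

Lemma polygon_piece_connected A : polygon_pieces A -> connected A.
Proof.
move=> [[|[|[|//]]]] /=.
- move=> [i im ->]; apply: set_type_connected; last exact: connected1.
  by move=> _ ->; exact: polygon_vertexP.
- move=> [i im ->]; apply: set_type_connected; first exact: polygon_edge_sub.
  apply: (@star_shaped_connected R 2 _
    ((1 / 2) *: polygon_vertex R m i + (1 / 2) *: polygon_vertex R m i.+1)).
  move=> _ s [t [t0 t1 ->]] /andP[s0 s1]; exists ((1 - s) / 2 + s * t); split.
  + nra.
  + nra.
  + by apply/rowP => j; rewrite !mxE; field.
- move=> ->; apply: set_type_connected; first exact: interior_subset.
  have [q Pq] := polygon_interior_nonempty R m3.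
  apply: (@star_shaped_connected R 2 _ q) => x s Px s01.
  by apply: convex_interior => //; exact: polygon_convex.
Qed.

(** Balls and the interior of a polygon are convex. *)
Lemma polygon_face_local (p : P) (V : set P) : nbhs p V ->
  exists W, [/\ nbhs p W, W `<=` V & connected (W `&` polygon_face)].
Proof.
move=> /set_type_nbhs[W /nbhs_ballP[r /= r0 rW] WV].
exists (set_val @^-1` ball (set_val p) r); split.
- by apply: set_val_continuous; exact: nbhsx_ballx.
- by move=> z bz; apply/WV/rW.
- rewrite -preimage_setI; apply: set_type_connected.
    by move=> z [_ /interior_subset].
  by apply: ball_interior_connected; exact: polygon_convex.
Qed.

Lemma polygon_face_dense (p : P) (V : set P) : nbhs p V ->
  V `&` polygon_face !=set0.
Proof.
move=> /set_type_nbhs[W nW WV].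
have [z [Wz Pz]] := interior_dense (@polygon_convex R m)
  (polygon_interior_nonempty R m3) (set_valP p) nW.
exists (exist _ z (mem_set (interior_subset Pz))); split => //.
exact: WV.
Qed.

Lemma polygon_type_compact : compact [set: P].
Proof. exact: set_type_compact (polygon_compact m3). Qed.

Lemma polygon_type_hausdorff : hausdorff_space P.
Proof. by apply: set_type_hausdorff; exact: norm_hausdorff. Qed.

End PolygonPieces.

Section TileTypes.
Variables (R : realType) (F : subdivision_rule R).
Local Notation D := (@fsr_cells R F).
Local Notation K c := (set_type (polygon R (fsr_sides c))).
Local Notation O c := (@polygon_face R (@fsr_sides R F c)).

Let cwD : is_CW2 R D := fsr_cw F.

(** The tile structure only says that the face is mapped onto some cell.  That
    cell has dimension two, as it contains a copy of a planar region, and it lies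
    in the closure of [c]. *)
Lemma tile_face c : D 2%N c -> homeo_on (@fsr_tile R F c) (O c) c.
Proof.
move=> Dc; have m3 := fsr_sides_ge3 Dc.
have [cg _ pg] := fsr_tile_structure Dc.
have [j [d [Dd hd]]] := pg 2%N (O c) erefl.
suff e : c = d by rewrite -e in hd.
have [q Pq] := polygon_interior_nonempty R m3.
pose q0 : K c := exist _ q (mem_set (interior_subset Pq)).
have gd p : O c p -> d (fsr_tile p).
  by move=> Op; rewrite -(homeo_image hd); exists p.
have j2 : (2 <= j)%N.
  rewrite leqNgt; apply/negP => j2.
  have [psi [_ hpsi _]] := cell_char cwD Dd.
  have [cpsi [pi' [cpi psiA piB]]] := hpsi.
  apply: (@open_no_injection R j (polygon R (fsr_sides c))°
    (pi' \o (@fsr_tile R F c \o to_set_type q0)) j2).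
  - exact: open_interior.
  - by exists q.
  - apply: (within_comp (B := d)) => //.
    + apply: (within_comp (B := setT)) => //.
        apply: (continuous_subspaceW (@interior_subset _ _)).
        exact: to_set_type_continuous.
      exact: continuous_subspaceT.
    + move=> x Px; apply: gd; rewrite /polygon_face /preimage /=.
      by rewrite set_val_to_set_type //; exact: interior_subset.
  - move=> x y Px Py /(congr1 psi) /=.
    have JP z (Pz : (polygon R (fsr_sides c))° z) : O c (to_set_type q0 z).
      rewrite /polygon_face /preimage /= set_val_to_set_type //.
      exact: interior_subset.
    rewrite (piB _ (gd _ (JP _ Px))).2 (piB _ (gd _ (JP _ Py))).2.
    move=> /(homeo_inj hd (JP _ Px) (JP _ Py)) /(congr1 set_val).
    by rewrite !set_val_to_set_type //; exact: interior_subset.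
have {}j2 : j = 2%N by apply/eqP; rewrite eqn_leq j2 (cell_dim cwD Dd).
rewrite j2 in Dd.
apply: (closure_meets_2cell cwD Dc Dd (x := fsr_tile q0)); last exact: gd.
by rewrite -(fsr_tile_image Dc); exists q0.
Qed.

Lemma tile_piece c A : D 2%N c -> polygon_pieces A ->
  exists j d, D j d /\ homeo_on (@fsr_tile R F c) A d.
Proof.
move=> Dc [k kA]; have [_ _ pg] := fsr_tile_structure Dc.
exact: pg kA.
Qed.

Lemma tile_fiber c y : D 2%N c -> finite_set (@fsr_tile R F c @^-1` [set y]).
Proof.
move=> Dc; have m3 := fsr_sides_ge3 Dc.
rewrite -[X in finite_set X]setTI.
apply: (finite_fiber _ (polygon_pieces_finite R (fsr_sides c))).
  by move=> p _; have [A] := polygon_pieces_cover m3 p; exists A.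
move=> A PA x x'; have [j [d [_ hd]]] := tile_piece Dc PA.
exact: (homeo_inj hd).
Qed.

(** A condition on all tile types at once: a connected part of a polygon over
    [V] is so small that the closed pieces it touches have a common point. *)
Definition star_small (V : set F) := open V /\
  forall c, D 2%N c -> forall Q : set (K c), connected Q -> Q !=set0 ->
    @fsr_tile R F c @` Q `<=` V ->
    exists p, forall A, polygon_pieces A ->
      closure Q `&` closure A !=set0 -> closure A p.

Lemma star_small_cover : \bigcup_(V in star_small) V = setT.
Proof.
apply/seteqP; split => // y _.
have /choice[V hV] (c : set F) : exists V, D 2%N c ->
    [/\ open V, V y & forall Q : set (K c), connected Q -> Q !=set0 ->
    @fsr_tile R F c @` Q `<=` V ->
    exists p, forall A, polygon_pieces A ->
      closure Q `&` closure A !=set0 -> closure A p].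
  have [Dc|nD] := pselect (D 2%N c); last by exists setT.
  have m3 := fsr_sides_ge3 Dc.
  have [V VP] := @fiber_localization (K c) F (@fsr_tile R F c) (@polygon_pieces R _) y
    (@polygon_type_hausdorff R _) (polygon_type_compact m3)
    (cw_hausdorff cwD) (let: And3 h _ _ := fsr_tile_structure Dc in h)
    (polygon_pieces_finite _ _) (tile_fiber y Dc).
  by exists V.
exists (~` \bigcup_(c in D 2%N) ~` V c).
  split.
    apply: closed_openC; apply: closed_bigcup; first exact: fsr_finite.
    by move=> c Dc; apply: open_closedC; case: (hV c Dc).
  move=> c Dc Q cQ Q0 QV; have [_ _ +] := hV c Dc; apply => //.
  by move=> z /QV nz; apply: contrapT => nVz; apply: nz; exists c.
by move=> [c Dc]; apply; case: (hV c Dc).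
Qed.

Section Lift.
Variables (X : topologicalType) (C : cellulation X) (f : X -> F).
Hypotheses (cwC : is_CW2 R C) (sm : structure_map C D f).
Let cf : continuous f. Proof. by case: sm. Qed.

(** Every tile of an R-complex is a quotient of its tile type, compatibly with the
    cells.  A piece is mapped onto a whole cell because its image is connected
    and, by dimension, the cells of the tile over a given cell are closed within
    its preimage. *)
Lemma tile_lift e : C 2%N e -> exists G : K (f @` e) -> X,
  [/\ continuous G, (forall p, f (G p) = fsr_tile p),
      G @` O (f @` e) = e, range G = closure e &
      forall A, polygon_pieces A -> exists j, C j (G @` A)].
Proof.
move=> Ce; have [Dc hfe] := structure_map_cell cwC cwD sm Ce.
set c := f @` e in Dc hfe *.
have m3 := fsr_sides_ge3 Dc.
have hgO := tile_face Dc.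
have [cg _ _] := fsr_tile_structure Dc.
have [_ [fi [cfi fe fc]]] := hfe.
have gO p : O c p -> c (fsr_tile p).
  by have [_ [? [_ h _]]] := hgO => /h[].
pose G0 : K c -> X := fi \o @fsr_tile R F c.
have [E [fE EC sE cE _]] := cell_closure cwC Ce.
have Ecells e' : (e |` E) e' -> exists j, C j e'.
  by move=> [->|/EC[j _ Ce']]; [exists 2%N|exists j].
have fE' : finite_set (e |` E) by rewrite finite_setU; split.
have sE' : closure e `<=` \bigcup_(e' in e |` E) e'.
  by move=> x /sE[ex|[e' Ee' e'x]]; [exists e => //; left|exists e' => //; right].
have [||||||||G [cG GG0 GT fG]] := @extend_to_boundary (K c) X F (O c)
    (closure e) f (@fsr_tile R F c) G0 (cw_hausdorff cwC) (cw_hausdorff cwD).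
- exact: cE.
- exact: cf.
- exact: cg.
- by move=> p V; exact: polygon_face_local.
- by move=> p V; exact: polygon_face_dense.
- apply: (within_comp (B := c)) => //; exact: continuous_subspaceT.
- move=> p Op; have [ep fp] := fc _ (gO _ Op); split => //.
  exact: subset_closure.
- move=> y; apply: (finite_fiber _ fE' sE') => e' Ee' x x'.
  have [j Ce'] := Ecells _ Ee'.
  by have [_ he'] := structure_map_cell cwC cwD sm Ce'; exact: (homeo_inj he').
have GO : G @` O c = e.
  apply/seteqP; split=> [_ [p Op <-]|x ex].
    by rewrite GG0 //; case: (fc _ (gO _ Op)).
  have [p Op gp] : exists2 p, O c p & @fsr_tile R F c p = f x.
    case: hgO => _ [gi [_ _ gc]]; have [|Op gp] := gc (f x); first by exists x.
    by exists (gi (f x)).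
  by exists p => //; rewrite GG0 // /G0 /= gp; case: (fe _ ex).
exists G; split => //.
- apply/seteqP; split=> [_ [p _ <-]|]; first exact: GT.
  rewrite [X in _ `<=` X](closure_id _).1.
    by apply: closureS; rewrite -GO => _ [p _ <-]; exists p.
  apply: (compact_closed (cw_hausdorff cwC)); apply: continuous_compact.
    exact: continuous_subspaceT.
  exact: polygon_type_compact.
- move=> A PA; have [j [d [Dd hd]]] := tile_piece Dc PA.
  have gA := homeo_image hd.
  have dG x : (G @` A) x -> d (f x).
    by move=> [p Ap <-]; rewrite fG -gA; exists p.
  have [||||||e' [Ee' fe'] Ae'] := connected_sub_closure
      (D := (e |` E) `&` [set e' | f @` e' = d]) (Q := G @` A).
  + apply: connected_continuous_connected; first exact: polygon_piece_connected.
    exact: continuous_subspaceT.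
  + have [y dy] := cell_nonempty cwD Dd.
    by move: dy; rewrite -gA => -[p Ap _]; exists (G p), p.
  + by apply: sub_finite_set fE' => ? [].
  + move=> U V [/Ecells[i CU] _] [/Ecells[i' CV] _] [x [Ux Vx]].
    by case: (cell_uniq cwC CU CV Ux Vx).
  + move=> U [/Ecells[i CU] fU] x [/dG dx Ux].
    have [DU _] := structure_map_cell cwC cwD sm CU.
    rewrite fU in DU; apply: (structure_map_closure_cell cwC cwD sm CU DU erefl).
    by split.
  + move=> x Ax; have [p Ap Gp] := Ax.
    have [e' Ee' e'x] : (\bigcup_(e' in e |` E) e') x.
      by apply: sE'; rewrite -Gp; exact: GT.
    exists e' => //; split => //; have [i Ce'] := Ecells _ Ee'.
    have [De' _] := structure_map_cell cwC cwD sm Ce'.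
    by have [_ fe'] := cell_uniq cwD De' Dd (imageP _ e'x) (dG _ Ax).
  have [i Ce'] := Ecells _ Ee'; exists i.
  suff -> : G @` A = e' by [].
  apply/seteqP; split => // y e'y.
  have : (@fsr_tile R F c @` A) (f y) by rewrite gA -fe'; exists y.
  move=> [p Ap gp]; exists p => //.
  have [_ he'] := structure_map_cell cwC cwD sm Ce'.
  apply: (homeo_inj he') => //; last by rewrite fG gp.
  by apply: Ae'; exists p.
Qed.

(** The closure of a cell of a CW complex need not be a subcomplex; here it is one,
    because the boundary of the polygon is mapped cell by cell. *)
Lemma closed_2cell_subcomplex e j e' : C 2%N e -> C j e' ->
  e' `&` closure e !=set0 -> closure e' `<=` closure e.
Proof.
move=> Ce Ce' [x [e'x]].
have [Dc _] := structure_map_cell cwC cwD sm Ce.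
have [G [_ _ _ rG GA]] := tile_lift Ce.
rewrite -{1}rG => -[p _ Gp].
have [A PA Ap] := polygon_pieces_cover (fsr_sides_ge3 Dc) p.
have [i CA] := GA _ PA.
have GAx : (G @` A) x by exists p.
have [_ eA] := cell_uniq cwC CA Ce' GAx e'x.
rewrite [X in _ `<=` X](closure_id _).1; last exact: closed_closure.
by apply: closureS; rewrite -eA -rG => _ [q _ <-]; exists q.
Qed.

(** The set [Q] is lifted to the polygon, where [star_small] provides a point; the
    image of that point belongs to every tile touching the closure of [Q]. *)
Lemma star_point e (Q : set X) (V : set F) : C 2%N e -> connected Q ->
  Q !=set0 -> Q `<=` e -> star_small V -> f @` Q `<=` V ->
  exists x, forall t, is_tile C t -> closure Q `&` t !=set0 -> t x.
Proof.
move=> Ce cQ [x0 Qx0] Qe [_ sV] QV.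
have [Dc hfe] := structure_map_cell cwC cwD sm Ce.
have m3 := fsr_sides_ge3 Dc.
have [G [cG fG GO rG GA]] := tile_lift Ce.
set c := f @` e in Dc hfe G cG fG GO rG GA m3.
have hgO := tile_face Dc.
have [_ [gi [cgi gO gc]]] := hgO.
pose Q' : set (K c) := (gi \o f) @` Q.
have Qc x : Q x -> c (f x) by move=> /Qe ex; exists x.
have GQ' x : Q x -> G (gi (f x)) = x.
  move=> Qx; have [Op gp] := gc _ (Qc _ Qx).
  apply: (homeo_inj hfe); [|exact: Qe|by rewrite fG].
  by rewrite -GO; exists (gi (f x)).
have [||| p hp] := sV c Dc Q'.
- apply: connected_continuous_connected => //.
  by apply: (within_comp (B := c)) => //; exact: continuous_subspaceT.
- by exists (gi (f x0)), x0.
- move=> _ [_ [x Qx <-] <-] /=; rewrite (gc _ (Qc _ Qx)).2.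
  by apply: QV; exists x.
exists (G p) => t [e1 Ce1 ->] [x [clx tx]].
have : (G @` closure Q') x.
  have : closed (G @` closure Q').
    apply: (compact_closed (cw_hausdorff cwC)); apply: continuous_compact.
      exact: continuous_subspaceT.
    apply: (@subclosed_compact _ _ setT) => //; first exact: closed_closure.
    exact: polygon_type_compact.
  move=> /closure_id ->; apply: closureS clx => y Qy.
  exists (gi (f y)); last exact: GQ'.
  by apply: subset_closure; exists y.
move=> [q Q'q Gq].
have [A PA Aq] := polygon_pieces_cover m3 q.
have [j CA] := GA _ PA.
have GAt : closure (G @` A) `<=` closure e1.
  by apply: (closed_2cell_subcomplex Ce1 CA); exists x; split => //; exists q.
apply: GAt.
have pA : closure A p by apply: hp => //; exists q; split => //; exact: subset_closure.
move=> W nW; have [z [Az Wz]] := pA _ (cG _ _ nW).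
by exists (G z); split => //; exists z.
Qed.

End Lift.
End TileTypes.

(** * The inverse of the expansion map acting on tiles *)

Lemma closure_image (T U : topologicalType) (g : T -> U) (A : set T) :
  continuous g -> g @` closure A `<=` closure (g @` A).
Proof.
move=> cg _ [x clx <-] W nW; have [z [Az Wz]] := clx _ (cg _ _ nW).
by exists (g z); split => //; exists z.
Qed.

Lemma iter_continuous (T : topologicalType) (g : T -> T) n :
  continuous g -> continuous (iter n g).
Proof.
move=> cg; elim: n => [|n IH] x; first exact: cvg_id.
exact: (continuous_comp (IH x) (cg _)).
Qed.

Section Dynamics.
Variables (R : realType) (F : subdivision_rule R).
Variables (X : topologicalType) (C : cellulation X) (f : X -> F).
Variables (phi psi : X -> X).
Local Notation D := (@fsr_cells R F).
Local Notation D' := (@fsr_subcells R F).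
Local Notation sigma := (@fsr_map R F).
Hypotheses (cwC : is_CW2 R C) (sm : structure_map C D f).
Hypotheses (cpsi : continuous psi) (psiK : cancel psi phi).
Hypothesis semiconj : forall x, sigma (f x) = f (phi x).
Let cwD : is_CW2 R D := fsr_cw F.
Let cwD' : is_CW2 R D' := (fsr_subdivision F).1.
Let cf : continuous f. Proof. by case: sm. Qed.

Lemma semiconj_iter n x : iter n sigma (f (iter n psi x)) = f x.
Proof.
elim: n x => [//|n IH] x.
by rewrite iterSr /= semiconj psiK IH.
Qed.

(** The image of [psi @` e] under [f] is connected and [sigma] maps it into a
    2-cell, so it lies in one 2-cell [c] of the subdivided rule; likewise
    [psi @` e] lies in one cell of X over the cell containing [c].  Both
    inclusions into preimages are equalities by injectivity on open cells. *)
Lemma pullback_2cell e : C 2%N e -> exists e0 c,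
  [/\ C 2%N e0, D' 2%N c, c `<=` f @` e0 & psi @` e = e0 `&` f @^-1` c].
Proof.
move=> Ce; have [De he] := structure_map_cell cwC cwD sm Ce.
have [x0 ex0] := cell_nonempty cwC Ce.
have cQ : connected (psi @` e).
  apply: connected_continuous_connected; first exact: cell_connected cwC _ _ Ce.
  exact: continuous_subspaceT.
have cfQ : connected (f @` (psi @` e)).
  by apply: connected_continuous_connected => //; exact: continuous_subspaceT.
have sfQ y : (f @` (psi @` e)) y -> (f @` e) (sigma y).
  by move=> [_ [x ex <-] <-]; rewrite semiconj psiK; exists x.
have [|c [Dc Qc sc]] := structure_map_2cell_lift cwD' cwD (fsr_map_structure F)
  cfQ _ De sfQ.
  by exists (f (psi x0)), (psi x0) => //; exists x0.
have [j [d [Dd cd]]] := (fsr_subdivision F).2 _ _ Dc.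
have j2 : (2 <= j)%N.
  apply: (homeo_cell_dim cwD' cwD Dc Dd (f := id)) => //.
  by apply: continuous_subspaceT => x; exact: cvg_id.
have {}j2 : j = 2%N by apply/eqP; rewrite eqn_leq j2 (cell_dim cwD Dd).
rewrite j2 in Dd.
have [|x Qx|e0 [Ce0 Qe0 fe0]] := structure_map_2cell_lift cwC cwD sm cQ _ Dd.
- by exists (psi x0), x0.
- by apply/cd/Qc; exists x.
exists e0, c; split => //; first by rewrite fe0.
apply/seteqP; split=> [x Qx|x [e0x cx]].
  by split; [exact: Qe0|apply: Qc; exists x].
have : (f @` e) (sigma (f x)) by rewrite -sc; exists (f x).
move=> [z ez fz]; exists z => //.
have [_ he0] := structure_map_cell cwC cwD sm Ce0.
apply: (homeo_inj he0) => //; first by apply: Qe0; exists z.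
have [_ hc] := structure_map_cell cwD' cwD (fsr_map_structure F) Dc.
apply: (homeo_inj hc) => //; first by apply: Qc; exists (psi z) => //; exists z.
by rewrite semiconj psiK.
Qed.

Lemma pullback_iter_2cell n e : C 2%N e ->
  exists2 e0, C 2%N e0 & iter n psi @` e `<=` e0.
Proof.
elim: n e => [|n IH] e Ce; first by exists e => // _ [x ex <-].
have [e0 [c [Ce0 _ _ eE]]] := pullback_2cell Ce.
have [e1 Ce1 e01] := IH _ Ce0; exists e1 => // _ [x ex <-].
rewrite iterSr; apply: e01; exists (psi x) => //.
by have [] : (e0 `&` f @^-1` c) (psi x) by rewrite -eE; exists x.
Qed.

Lemma pullback_iter_subdivide n e : C 2%N e ->
  exists2 a, iter_subdivide D id n 2%N a & f @` (iter n psi @` e) `<=` a.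
Proof.
elim: n e => [|n IH] e Ce.
  exists (f @` e); first by case: (structure_map_cell cwC cwD sm Ce).
  by move=> _ [_ [x ex <-] <-]; exists x.
have [e0 [c [Ce0 Dc ce0 eE]]] := pullback_2cell Ce.
have [a Da e0a] := IH _ Ce0.
have ha x : e0 x -> a (f (iter n psi x)).
  by move=> e0x; apply: e0a; exists (iter n psi x) => //; exists x.
exists (a `&` (fun x => iter n sigma (id x)) @^-1` c).
  exists 2%N, a, c; split => // y /ce0[x e0x <-].
  by exists (f (iter n psi x)); [exact: ha|exact: semiconj_iter].
move=> _ [_ [x ex <-] <-]; rewrite iterSr.
have [e0x cx] : (e0 `&` f @^-1` c) (psi x) by rewrite -eE; exists x.
by split; [exact: ha|rewrite /preimage /= semiconj_iter].
Qed.

Hypothesis mesh : mesh_to_zero F.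

(** Only the rule enters in the choice of [N], which is what makes it uniform in
    the tile [e]. *)
Lemma exists_star_level : exists N, forall e, C 2%N e -> exists x,
  forall t, is_tile C t -> (iter N psi @` closure e) `&` t !=set0 -> t x.
Proof.
have [|N _ hN] := mesh _ (star_small_cover F); first by move=> V [].
exists N => e Ce.
have [a Da ea] := pullback_iter_subdivide N Ce.
have [|V sV aV] := hN (closure a); first by exists a.
have [e0 Ce0 ee0] := pullback_iter_2cell N Ce.
have [|||x hx] := star_point cwC sm Ce0 (Q := iter N psi @` e) _ _ ee0 sV.
- apply: connected_continuous_connected; first exact: cell_connected cwC _ _ Ce.
  by apply: continuous_subspaceT; exact: iter_continuous.
- by have [x ex] := cell_nonempty cwC Ce; exists (iter N psi x), x.
- by move=> y /ea ay; apply/aV/subset_closure.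
exists x => t Ct [y [ey ty]]; apply: hx => //; exists y; split => //.
by apply: closure_image ey; exact: iter_continuous.
Qed.

Variable S : set X.
Hypotheses (subS : subcomplex C S) (psiS : forall x, S x -> S (psi x)).
Hypothesis coverS : forall x, exists n, S (iter n psi x).
Hypothesis compS : compact S.
Hypothesis nbhdS : exists2 K, compact K & S `<=` K°.

Lemma iter_psiS n x : S x -> S (iter n psi x).
Proof. by move=> Sx; elim: n => // n IH; exact: psiS. Qed.

Lemma subcomplex_pullback_tile n t : is_tile C t ->
  exists T, [/\ is_tile C T, iter n psi @` t `<=` T & t `<=` S -> T `<=` S].
Proof.
move=> [e Ce ->]; have [e0 Ce0 ee0] := pullback_iter_2cell n Ce.
exists (closure e0); split; first by exists e0.
  apply: subset_trans (closureS ee0).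
  by apply: closure_image; exact: iter_continuous.
move=> eS; apply: (subS Ce0); have [x ex] := cell_nonempty cwC Ce.
exists (iter n psi x); split; first by apply: ee0; exists x.
exact/iter_psiS/eS/subset_closure.
Qed.

(** The iterated preimage of a tile lies in one tile, and a subcomplex contains
    every tile whose open cell it meets. *)
Lemma pullback_meets_seed n e : C 2%N e ->
  (iter n psi @` e) `&` S !=set0 -> iter n psi @` closure e `<=` S.
Proof.
move=> Ce [x [ex Sx]]; have [e0 Ce0 ee0] := pullback_iter_2cell n Ce.
have e0S : closure e0 `<=` S by apply: (subS Ce0); exists x; split => //; exact: ee0.
apply: subset_trans e0S; apply: subset_trans (closureS ee0).
by apply: closure_image; exact: iter_continuous.
Qed.

(** The open 2-cells of the n-th image of the seed under the expansion map. *)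
Definition seed_cells n := [set e | C 2%N e /\ iter n psi @` e `<=` S].

(** By [pullback_2cell], a cell of level [n.+1] is determined by a cell of level
    [n] and a 2-cell of the subdivided rule. *)
Lemma seed_cells_count : exists k m, forall n, exists2 s : seq (set X),
  (size s <= k * m ^ n)%N & forall e, seed_cells n e -> e \in s.
Proof.
have cF : compact [set: F].
  have -> : [set: F] = \bigcup_(e in D 2%N) closure e.
    apply/seteqP; split => // x _.
    have : (\bigcup_(t in is_tile D) t) x by rewrite (fsr_union F).
    by move=> [_ [e De ->] ex]; exists e.
  have fD := fsr_finite F 2%N.
  rewrite -bigsetU_fset_set // big_seq; apply: bigsetU_compact => e.
  rewrite in_fset_set // inE => De.
  exact: (closure_cell_compact cwD De).
have /finite_seqP[s' hs'] := finite_2cells_meeting cwD' cF.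
have /finite_seqP[s0 hs0] := finite_2cells_meeting cwC compS.
exists (size s0), (size s'); elim=> [|n [s ss hs]].
  exists s0; first by rewrite muln1.
  move=> e [Ce eS]; have [x ex] := cell_nonempty cwC Ce.
  have : [set e | C 2%N e /\ e `&` S !=set0] e.
    by split => //; exists x; split => //; apply: eS; exists x.
  by rewrite hs0.
(* the inverse of the correspondence of [pullback_2cell] *)
exists [seq phi @` (e0 `&` f @^-1` c) | e0 <- s, c <- s'].
  by rewrite size_allpairs expnSr mulnA leq_mul2r ss orbT.
move=> e [Ce eS]; have [e0 [c [Ce0 Dc ce0 eE]]] := pullback_2cell Ce.
have [x ex] := cell_nonempty cwC Ce.
have e0x : e0 (psi x).
  by have [] : (e0 `&` f @^-1` c) (psi x) by rewrite -eE; exists x.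
apply/allpairsP; exists (e0, c); split => /=.
- apply: hs; split => //.
  apply: subset_trans (image_subset _ (@subset_closure _ e0)) _.
  apply: pullback_meets_seed => //; exists (iter n psi (psi x)); split.
    by exists (psi x).
  by rewrite -iterSr; apply: eS; exists x.
- have : [set e | D' 2%N e /\ e `&` setT !=set0] c.
    by split => //; rewrite setIT; exact: (cell_nonempty cwD' Dc).
  by rewrite hs'.
- rewrite -eE; apply/seteqP; split=> [y ey|_ [_ [y ey <-] <-]].
    by exists (psi y); [exists y|exact: psiK].
  by rewrite psiK.
Qed.

Lemma tiles_meeting_seed_finite :
  finite_set [set t | is_tile C t /\ t `&` S !=set0].
Proof.
have [K cK SK] := nbhdS.
apply: (sub_finite_set _ (finite_image closure (finite_2cells_meeting cwC cK))).
move=> t [[e Ce ->] [x [clx Sx]]]; exists e => //; split => //.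
have [z [ez Kz]] := clx _ (open_nbhs_nbhs (conj (open_interior K) (SK _ Sx))).
by exists z; split => //; exact: interior_subset.
Qed.

(** Local finiteness leaves finitely many tiles to absorb, and each of them meets
    some image of the seed. *)
Lemma neighbours_absorbed : exists N, forall t, is_tile C t ->
  t `&` S !=set0 -> iter N psi @` t `<=` S.
Proof.
have /choice[n hn] (t : set X) : exists n, is_tile C t -> iter n psi @` t `<=` S.
  have [[e Ce ->]|nt] := pselect (is_tile C t); last by exists 0%N.
  have [x ex] := cell_nonempty cwC Ce; have [n Sn] := coverS x.
  exists n => _; apply: pullback_meets_seed => //.
  by exists (iter n psi x); split => //; exists x.
have /finite_seqP[s hs] := tiles_meeting_seed_finite.
exists (\max_(t <- s) n t) => t Ct tS.
have ts : t \in s.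
  by have : [set t | is_tile C t /\ t `&` S !=set0] t by []; rewrite hs.
have nle : (n t <= \max_(t <- s) n t)%N by exact: leq_bigmax_seq.
move=> _ [x tx <-]; rewrite -(subnK nle) iterD; apply: iter_psiS.
by apply: (hn t) => //; exists x.
Qed.

Lemma skinny_path_pad t m m' : (m <= m')%N -> skinny_path C S t m ->
  skinny_path C S t m'.
Proof.
move=> mm' [s [Cs s0 st hs]]; exists (fun i => s (minn i m)); split.
- by move=> i _; apply: Cs; exact: geq_minr.
- by rewrite min0n.
- by rewrite (minn_idPr mm').
- move=> i /andP[i1 _] /=; have [im|mi] := leqP i m.
    rewrite (minn_idPl _) //; last exact: leq_trans (leq_pred _) im.
    by apply: hs; rewrite i1.
  rewrite (minn_idPr _); last by rewrite -ltnS prednK.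
  have [e Ce ->] := Cs m (leqnn m); have [x ex] := cell_nonempty cwC Ce.
  by exists x; split; exact: subset_closure.
Qed.

(** Keep the tiles around the images of every other tile of the path.  Two
    successive ones meet at the star point of the tile skipped between them. *)
Lemma skinny_path_halve N :
  (forall e, C 2%N e -> exists x, forall t, is_tile C t ->
     (iter N psi @` closure e) `&` t !=set0 -> t x) ->
  forall t m, skinny_path C S t m -> exists T,
    iter N psi @` t `<=` T /\ skinny_path C S T (uphalf m).
Proof.
move=> hN t m [s [Cs s0 st hs]].
have /choice[T hT] (u : set X) : exists T, is_tile C u ->
    [/\ is_tile C T, iter N psi @` u `<=` T & u `<=` S -> T `<=` S].
  have [Cu|nu] := pselect (is_tile C u); last by exists u.
  by have [T hT] := subcomplex_pullback_tile N Cu; exists T.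
have CsT i : (i <= m)%N -> [/\ is_tile C (T (s i)),
    iter N psi @` s i `<=` T (s i) & s i `<=` S -> T (s i) `<=` S].
  by move=> im; apply/hT/Cs.
exists (T t); split; first by rewrite -st; case: (CsT m).
(* truncation at [m] makes the last step reach [t] also when [m] is odd *)
exists (fun i => T (s (minn i.*2 m))); split.
- by move=> i _; case: (CsT (minn i.*2 m)) => //; exact: geq_minr.
- by rewrite min0n; case: (CsT 0%N) => // _ _; apply.
- rewrite (minn_idPr _) ?st //; lia.
- move=> i /andP[i1 im].
  set b := i.-1.*2; have bE : minn i.-1.*2 m = b by apply/minn_idPl; lia.
  rewrite bE.
  have [|[] ] : minn i.*2 m = b.+1 \/ minn i.*2 m = b.+2 /\ (b.+2 <= m)%N by lia.
    move=> e; have bm : (b.+1 <= m)%N by lia.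
    rewrite e; have [|y [y1 y2]] := hs b.+1; first by rewrite /= bm.
    have [_ h1 _] := CsT _ bm; have [_ h2 _] := CsT _ (ltnW bm).
    by exists (iter N psi y); split; [apply: h1|apply: h2]; exists y.
  move=> -> bm.
  have [_ h0 _] := CsT b (ltnW (ltnW bm)); have [_ h2 _] := CsT _ bm.
  have [e Ce se] := Cs b.+1 (ltnW bm).
  have [x hx] := hN e Ce.
  have [|y [y1 y2]] := hs b.+1; first by rewrite /= ltnW.
  have [|z [z1 z2]] := hs b.+2; first by rewrite /= bm.
  exists x; split; apply: hx.
  + by case: (CsT b.+2).
  + exists (iter N psi z); split; first by exists z => //; rewrite -se.
    by apply: h2; exists z.
  + by case: (CsT b) => //; lia.
  + exists (iter N psi y); split; first by exists y => //; rewrite -se.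
    by apply: h0; exists y.
Qed.

(** After [k] halvings the last tile of the path touches the seed. *)
Lemma skinny_path_absorbed : exists N N0, forall k t m, (m <= 2 ^ k)%N ->
  skinny_path C S t m -> iter (k * N + N0) psi @` t `<=` S.
Proof.
have [N hN] := exists_star_level; have [N0 hN0] := neighbours_absorbed.
exists N, N0; elim=> [|k IH] t m mk tm.
  have [s [Cs s0 <- hs]] := skinny_path_pad mk tm.
  rewrite mul0n; apply: hN0; first exact: Cs.
  have [|x [x1 x0]] := hs 1%N; first by [].
  by exists x; split => //; exact: s0.
have [T [tT Tm]] := skinny_path_halve hN tm.
have mk' : (uphalf m <= 2 ^ k)%N by move: mk; rewrite expnS; lia.
move=> _ [x tx <-]; rewrite (_ : k.+1 * N + N0 = k * N + N0 + N)%N; last by lia.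
rewrite iterD; apply: (IH T (uphalf m)) => //; exists (iter N psi x) => //.
by apply: tT; exists x.
Qed.

Lemma skinny_ball_count : exists a b, forall n k, (n <= 2 ^ k)%N ->
  exists2 s : seq (set X), (size s <= a * b ^ k)%N &
    forall t, skinny_ball C S n t -> t \in s.
Proof.
have [K [M hKM]] := seed_cells_count.
have [N [N0 hN]] := skinny_path_absorbed.
exists (K * M ^ N0)%N, (M ^ N)%N => n k nk.
have [s ss hs] := hKM (k * N + N0)%N.
exists (map closure s).
  rewrite size_map; apply: leq_trans ss _.
  by rewrite expnD -expnM [(N * k)%N]mulnC; lia.
move=> t [Ct [m mn tm]].
have tpath : skinny_path C S t m.
  case: tm => [[tS ->]|[]//]; exists (fun=> t); split => //.
  by move=> i /andP[]; case: i.
have tS := hN _ _ _ (leq_trans mn nk) tpath.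
case: Ct tS => e Ce -> eS; apply: map_f; apply: hs; split => //.
by apply: subset_trans eS; apply: image_subset; exact: subset_closure.
Qed.

End Dynamics.

(** * From dyadic bounds to polynomial growth *)

(** With [2 ^ k <= n < 2 ^ k.+1] the hypothesis bounds [ln (b n)] by an affine
    function of [ln n].  The value at [n = 0] and [n = 1], where [ln n = 0], is 0
    by the convention on division. *)
Lemma polynomial_growth_bound (R : realType) (b : nat -> nat) (A B : nat) :
  (forall n k, (n <= 2 ^ k)%N -> (b n <= A * B ^ k)%N) -> polynomial_growth R b.
Proof.
move=> hb; set u : nat -> R := fun n => ln (b n)%:R / ln n%:R.
have lnn n : 0 <= ln (n%:R : R).
  by case: n => [|n]; [rewrite ln0|rewrite ln_ge0 // ler1n].
have u0 n : 0 <= u n by rewrite /u divr_ge0.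
have ln2p : 0 < ln (2 : R) by rewrite ln_gt0 // ltr1n.
have key (x y p q l kk : R) : 0 <= y -> x <= p + (kk + 1) * q ->
    kk * l <= y -> l <= y -> 0 < l -> 0 <= p -> 0 <= q ->
    x * l <= (p + q + q) * y.
  move=> y0 xp kl ly l0 p0 q0.
  have e1 : x * l <= (p + (kk + 1) * q) * l by apply: ler_wpM2r => //; exact: ltW.
  have e2 : p * l <= p * y by apply: ler_wpM2l.
  have e3 : q * l <= q * y by apply: ler_wpM2l.
  have e4 : q * (kk * l) <= q * y by apply: ler_wpM2l.
  nra.
set c : R := (ln A.+1%:R + ln B.+1%:R + ln B.+1%:R) / ln 2.
have c0 : 0 <= c by apply: divr_ge0; [rewrite !addr_ge0|exact: ltW].
have uc n : u n <= c.
  have [|n2] := leqP n 1.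
    move=> n1; have -> : u n = 0; last by [].
    rewrite /u; have -> : ln (n%:R : R) = 0; last by rewrite invr0 mulr0.
    by case: n n1 => [|[|//]] _; [rewrite ln0|rewrite ln1].
  set k := trunc_log 2 n.
  have kn : (2 ^ k <= n < 2 ^ k.+1)%N by apply: trunc_log_bounds; lia.
  have kln : k%:R * ln 2 <= ln n%:R :> R.
    rewrite mulr_natl -lnXn // ler_ln ?posrE.
    - by rewrite -natrX ler_nat; case/andP: kn.
    - by rewrite exprn_gt0.
    - by rewrite ltr0n; lia.
  have l2n : ln 2 <= ln n%:R :> R.
    by rewrite ler_ln ?posrE ?ler_nat // ltr0n; lia.
  have bk : ln (b n)%:R <= ln A.+1%:R + k.+1%:R * ln B.+1%:R :> R.
    have [->|bn0] := posnP (b n).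
      by rewrite ln0 // addr_ge0 // mulr_ge0.
    rewrite mulr_natl -lnXn ?ltr0n // -lnM ?posrE ?ltr0n ?exprn_gt0 ?ltr0n //.
    rewrite -natrX -natrM ler_ln ?posrE ?ltr0n //; last first.
      by rewrite muln_gt0 expn_gt0.
    rewrite ler_nat; have : (n <= 2 ^ k.+1)%N by case/andP: kn => _ /ltnW.
    move=> /(hb n); move=> /leq_trans; apply; apply: leq_mul => //.
    by rewrite leq_exp2r.
  rewrite /u /c ler_pdivrMr; last exact: lt_le_trans l2n.
  rewrite mulrAC ler_pdivlMr //.
  apply: (key _ _ _ _ _ k%:R) => //; last by rewrite natr1.
have ge0 : (0 <= limn_esup (EFin \o u))%E.
  apply: le_ereal_inf_tmp => _ [V nV <-].
  have [n Vn] := filter_ex nV.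
  apply: (@le_trans _ _ (u n)%:E); first by rewrite lee_fin.
  by apply: ereal_sup_ubound; exists n.
have lec : (limn_esup (EFin \o u) <= c%:E)%E.
  apply: (@le_trans _ _ (ereal_sup ((EFin \o u) @` setT))).
    by apply: ereal_inf_lbound; exists setT => //; exact: filterT.
  by apply: ge_ereal_sup => _ [n _ <-]; rewrite lee_fin.
exists (fine (limn_esup (EFin \o u))); rewrite /polynomial_growth_degree fineK //.
by rewrite ge0_fin_numE //; apply: le_lt_trans lec _; rewrite ltry.
Qed.

Lemma compact_neighbourhood (R : realType) n (X : topologicalType)
    (h : X -> 'rV[R]_n) (S : set X) :
  homeo_on h setT setT -> compact S -> exists2 K, compact K & S `<=` K°.
Proof.
move=> [/(iffRL (continuous_subspace_setT _)) ch [g [/(iffRL (continuous_subspace_setT _)) cg hK gK]]] cS.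
have chS : compact (h @` S).
  by apply: continuous_compact => // ; exact: continuous_subspaceT.
have [M [_ hM]] := compact_bounded chS.
have {hM}hM x : S x -> `|h x| <= `|M| + 1.
  move=> Sx; apply: (hM (`|M| + 1)); last by exists x.
  by apply: le_lt_trans (ler_norm M) _; rewrite ltrDl.
set r := `|M| + 2.
exists (g @` closed_ball_ (fun x => `|x|) (0 : 'rV[R]_n) r).
  apply: continuous_compact; first exact: continuous_subspaceT.
  apply: bounded_closed_compact.
    exists r; split; first exact: num_real.
    move=> y ry x; rewrite /closed_ball_ /= sub0r normrN => xr.
    by apply: le_trans xr _; exact: ltW.
  exact: closed_closed_ball_.
move=> x Sx; have : nbhs x (h @^-1` ball (h x) 1).
  by apply: ch; exact: nbhsx_ballx.
apply: filterS => y; rewrite -ball_normE /= /ball_ /= => hxy.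
exists (h y); last by case: (hK y I).
rewrite /closed_ball_ /= sub0r normrN /r.
have := hM _ Sx; have := ler_normB (h x) (h x - h y).
rewrite opprB addrC subrK; lra.
Qed.

(* fset_set is junk on infinite sets, so the finiteness of the b_n is part of
   the claim. *)
Theorem theorem1 (R : realType) (F : subdivision_rule R)
    (X : topologicalType) (C : cellulation X) (f : X -> F) (phi : X -> X)
    (S : set X)
    (hval : bounded_valence F) (hmesh : mesh_to_zero F)
    (hX : expansion_complex C f phi) (hS : is_seed R C phi S) :
  (forall n : nat, finite_set (skinny_ball C S n)) /\
  polynomial_growth R (growth_coef C S).
Proof.
case: hX => -[cwC _ sm] [h hh] hphi _ semiconj.
case: hphi => _ [psi [/(iffRL (continuous_subspace_setT _)) cpsi phiK psiK]].
case: hS => subS [hd hhd] Sphi coverS.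
have {}phiK : cancel phi psi by move=> x; case: (phiK x I).
have {}psiK : cancel psi phi by move=> x; case: (psiK x I).
have psiS x : S x -> S (psi x) by move=> /Sphi[y Sy <-]; rewrite phiK.
have {}coverS x : exists n, S (iter n psi x).
  have : (\bigcup_n (iter n phi @` S)) x by rewrite coverS.
  move=> [n _ [y Sy <-]]; exists n.
  suff -> : iter n psi (iter n phi y) = y by [].
  by elim: n => // n IH; rewrite iterSr /= phiK.
have compS : compact S.
  rewrite -(homeo_image hhd); apply: continuous_compact; first by case: hhd.
  exact: disk_compact.
have [a [b hab]] := skinny_ball_count cwC sm cpsi psiK semiconj hmesh
  subS psiS coverS compS (compact_neighbourhood hh compS).
have fin n : finite_set (skinny_ball C S n).
  have [s _ hs] := hab n n (ltnW (ltn_expl n (ltnSn 1))).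
  exact: sub_finite_set (finite_seq s).
split => //; apply: (@polynomial_growth_bound R _ a b) => n k nk.
have [s ss hs] := hab n k nk; apply: leq_trans ss.
rewrite /growth_coef; apply: uniq_leq_size; first exact: fset_uniq.
by move=> t; rewrite in_fset_set // inE => /hs.
Qed.
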